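(* Let $n\ge 2$ and let $X_1,\ldots,X_n$ be independent, almost surely finite real-valued random variables such that $P(X_i>\min_{j\neq i}X_j)>0$ and $P(X_i<\min_{j\neq i}X_j)>0$ for all $1\le i\le n$. Then time and cause are independent for $X_1,\ldots,X_n$ if and only if there is a strictly increasing function $g:(0,\infty)\to\mathbb{R}$ such that $X_1,\ldots,X_n$ are all $g$-exponentially distributed or all $g$-geometrically distributed (with the same $g$ for all $i$).
   Context: A random variable $Z$ is independent of an event $A$ if $P(\{Z\le t\}\cap A)=P(Z\le t)P(A)$ for all $t\in\mathbb{R}$. For random variables $X_1,\ldots,X_n$, ''time and cause are independent'' means that $\min_{1\le i\le n}X_i$ is independent of each of the events $\{X_i>\min_{j\neq i}X_j\}$, $\{X_i=\min_{j\neq i}X_j\}$, $\{X_i<\min_{j\neq i}X_j\}$, for all $1\le i\le n$. Write $\sim$ for ''distributed as''. For a function $g:(0,\infty)\to\mathbb{R}$, a random variable $X$ has a $g$-exponential distribution if $X\sim g(V)$ where $V$ is exponentially distributed with some rate $\lambda>0$; it has a $g$-geometric distribution if $X\sim g(V)$ where $V$ is geometrically distributed on $\{1,2,\ldots\}$ with some success parameter $\alpha\in(0,1)$, i.e. $P(V=k)=\alpha(1-\alpha)^{k-1}$ for $k\ge 1$. When several random variables are said to have $g$-exponential (resp. $g$-geometric) distributions, the parameters $\lambda$ (resp. $\alpha$) may differ between them, but $g$ is the same for all. *)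

(* Defs.v *)
From mathcomp Require Export all_boot all_order all_algebra.
From mathcomp Require Export all_classical all_reals all_analysis.
From mathcomp Require Export measurable_realfun.

Set Implicit Arguments.
Unset Strict Implicit.
Unset Printing Implicit Defensive.

Import Order.TTheory GRing.Theory Num.Theory.

Local Open Scope classical_set_scope.
Local Open Scope ring_scope.
Local Open Scope ereal_scope.

(* MathComp-Analysis.  Random variables take values in \bar R, so that being
   almost surely finite is an actual hypothesis. *)

Definition mutually_independent d (T : measurableType d) (R : realType)
    (P : probability T R) (n : nat) (X : 'I_n -> {RV P >-> \bar R}) : Prop :=
  forall B : 'I_n -> set (\bar R), (forall i, measurable (B i)) ->
    P (\bigcap_(i in [set: 'I_n]) (X i @^-1` B i)) =
    \prod_(i < n) P (X i @^-1` B i).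

Definition independent_of_event d (T : measurableType d) (R : realType)
    (P : probability T R) (Z : T -> \bar R) (A : set T) : Prop :=
  forall t : R, P ([set w | Z w <= t%:E] `&` A) =
    P [set w | Z w <= t%:E] * P A.

Definition min_all d (T : measurableType d) (R : realType)
    (P : probability T R) (n : nat) (X : 'I_n -> {RV P >-> \bar R}) (w : T) :
    \bar R :=
  \big[Order.min/+oo]_(j < n) X j w.

(* The unit +oo is the value only when there is no j != i, i.e. n = 1. *)
Definition min_others d (T : measurableType d) (R : realType)
    (P : probability T R) (n : nat) (X : 'I_n -> {RV P >-> \bar R})
    (i : 'I_n) (w : T) : \bar R :=
  \big[Order.min/+oo]_(j < n | j != i) X j w.

Definition time_cause_independent d (T : measurableType d) (R : realType)
    (P : probability T R) (n : nat) (X : 'I_n -> {RV P >-> \bar R}) : Prop :=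
  forall i : 'I_n,
    [/\ independent_of_event P (min_all X) [set w | X i w > min_others X i w],
        independent_of_event P (min_all X) [set w | X i w = min_others X i w]
      & independent_of_event P (min_all X) [set w | X i w < min_others X i w]].

(* A function (0, oo) -> R is represented by a function on R of which only the
   values on positive reals are ever used. *)
Definition increasing_on_pos (R : realType) (g : R -> R) : Prop :=
  forall x y : R, (0 < x)%R -> (x < y)%R -> (g x < g y)%R.

(* [set v | 0 < v /\ A (g v)] is the event {g(V) in A} for V > 0; the
   exponential law gives mass 0 to the nonpositive reals. *)
Definition g_exponential d (T : measurableType d) (R : realType)
    (P : probability T R) (g : R -> R) (X : {RV P >-> \bar R}) : Prop :=
  exists2 lambda : R, (0 < lambda)%R &
    forall A : set (\bar R), measurable A ->
      distribution P X A =
      exponential_prob lambda [set v : R | (0 < v)%R /\ A (g v)%:E].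

Definition geometric_pmf (R : realType) (alpha : R) (k : nat) : R :=
  (if k is k'.+1 then alpha * (1 - alpha) ^+ k' else 0)%R.

Definition geometric_prob (R : realType) (alpha : R) (U : set nat) : \bar R :=
  \esum_(k in U) (geometric_pmf alpha k)%:E.

Definition g_geometric d (T : measurableType d) (R : realType)
    (P : probability T R) (g : R -> R) (X : {RV P >-> \bar R}) : Prop :=
  exists2 alpha : R, (0 < alpha < 1)%R &
    forall A : set (\bar R), measurable A ->
      distribution P X A =
      geometric_prob alpha [set k : nat | (0 < k)%N /\ A (g k%:R)%:E].

(* Main.v *)
Require Import Defs.
From mathcomp Require Import ring lra.

(* Fix i, let a and b be the survival functions of X_i and of
   Y = min_(j != i) X_j, let M = min(X_i, Y), with survival function S = a b, and
   let p, q, r be the probabilities of X_i < Y, X_i > Y, X_i = Y.  For s <= t,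
     (a s - a t) b t <= P(s < M, X_i < Y) - P(t < M, X_i < Y) <= (a s - a t) b s,
   and the lower bound is attained when P(s < M < t) = 0; similarly for the
   other two events.  If time and cause are independent, the middle term is
   p (S s - S t).
   - If r = 0, then S is continuous, so it takes every value e^-v, and comparing
     d log a with p d log S along fine partitions gives a = S^p: every X_i is
     g-exponential for g the quantile function g v = inf {t | S t <= e^-v}.
   - If r > 0, then S t < S s forces S t <= th S s with th = p q / (r + p q) < 1,
     so S is a step function jumping at atoms d_1 < d_2 < ..., and at each jump
     the three identities give a(d_(k+1)) = q / (q + r) a(d_k): every X_i is
     g-geometric with g k = d_k.
   Conversely, for survival functions x^k and y^k along a sequence of thresholds,
   the same bounds confine both P(t_k < M, X_i < Y) / S(t_k) and P(X_i < Y) to an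
   interval that is independent of k: a point in the geometric case, and one of
   length O(1/N) for the thresholds g(k u/N) in the exponential case. *)

Set Implicit Arguments.
Unset Strict Implicit.
Unset Printing Implicit Defensive.

Import Order.TTheory GRing.Theory Num.Theory.

Local Open Scope classical_set_scope.
Local Open Scope ring_scope.

(** * Probabilities of events and survival functions *)

Lemma ex_ltr_nat (R : realType) (x : R) : exists n : nat, x < n%:R.
Proof.
by exists (Num.bound `|x|); rewrite (le_lt_trans (ler_norm x))// archi_boundP.
Qed.

Lemma ex_ltr_invn (R : realType) (e : R) : 0 < e -> exists n : nat, n.+1%:R^-1 < e.
Proof.
move=> e0; have [n _ /(_ n (leqnn n))/= ne] := near_infty_natSinv_lt (PosNum e0).
by exists n.
Qed.

(** One kind of sequence covers right continuity at a real [s] and the limit at minus infinity when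
    [s] is [-oo]. *)
Lemma ex_right_seq (R : realType) (s : \bar R) : (s < +oo)%E ->
  exists u : nat -> R, [/\ forall n, (s < (u n)%:E)%E,
    forall m n, (m <= n)%N -> u n <= u m &
    forall x : \bar R, (s < x)%E -> exists n, ((u n)%:E < x)%E].
Proof.
case: s => [r _| //| _].
  exists (fun n => r + n.+1%:R^-1); split => [n|m n mn|[x| |]//].
  - by rewrite lte_fin ltrDl.
  - by rewrite lerD2l lef_pV2 ?posrE// ler_nat.
  - rewrite lte_fin -subr_gt0 => /ex_ltr_invn[n nz].
    by exists n; rewrite lte_fin -ltrBrDl.
  - by exists 0%N; rewrite ltry.
exists (fun n => - n%:R); split => [n|m n mn|[x| |]//].
- by rewrite ltNyr.
- by rewrite lerN2 ler_nat.
- by have [n rn] := ex_ltr_nat (- x); exists n; rewrite lte_fin ltrNl.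
- by exists 0%N; rewrite ltry.
Qed.

Definition pr d (T : measurableType d) (R : realType) (P : probability T R)
  (A : set T) : R := fine (P A).

Section RealProbability.
Context d (T : measurableType d) (R : realType) (P : probability T R).
Implicit Types A B C D : set T.

Lemma prE A : measurable A -> P A = (pr P A)%:E.
Proof. by move=> mA; rewrite /pr fineK// fin_num_measure. Qed.

Lemma pr_ge0 A : 0 <= pr P A.
Proof. by rewrite /pr fine_ge0. Qed.

Lemma pr_setT : pr P setT = 1.
Proof. by rewrite /pr probability_setT. Qed.

Lemma pr_set0 : pr P set0 = 0.
Proof. by rewrite /pr measure0. Qed.

Lemma le_pr A B : measurable A -> measurable B -> A `<=` B -> pr P A <= pr P B.
Proof.
by move=> mA mB AB; rewrite -lee_fin -!prE//; apply: le_measure; rewrite ?inE.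
Qed.

Lemma pr_le1 A : measurable A -> pr P A <= 1.
Proof. by move=> mA; rewrite -pr_setT le_pr. Qed.

Lemma pr_setD A B : measurable A -> measurable B -> A `<=` B ->
  pr P (B `\` A) = pr P B - pr P A.
Proof.
move=> mA mB AB; apply/EFin_inj; rewrite EFinB -!prE//; last exact: measurableD.
by rewrite measureD// ?setIidr// -ge0_fin_numE// fin_num_measure.
Qed.

Lemma pr_setC A : measurable A -> pr P (~` A) = 1 - pr P A.
Proof. by move=> mA; rewrite -setTD pr_setD// pr_setT. Qed.

Lemma pr_setUI A B : measurable A -> measurable B ->
  pr P (A `|` B) + pr P (A `&` B) = pr P A + pr P B.
Proof.
move=> mA mB.
have -> : A `|` B = A `|` (B `\` A `&` B).
  apply/seteqP; split => w /=; have [] := pselect (A w); tauto.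
have mD : measurable (B `\` A `&` B).
  by apply: measurableD => //; exact: measurableI.
have -> : pr P (A `|` (B `\` A `&` B)) = pr P A + pr P (B `\` A `&` B).
  apply/EFin_inj; rewrite EFinD -!prE//; last exact: measurableU.
  by rewrite measureU//; apply/seteqP; split => w //= [Aw [Bw]]; apply.
by rewrite pr_setD//; [lra|exact: measurableI].
Qed.

Lemma pr_setU_le A B : measurable A -> measurable B ->
  pr P (A `|` B) <= pr P A + pr P B.
Proof. by move=> mA mB; rewrite -pr_setUI// lerDl pr_ge0. Qed.

(* The inclusions say [1_A + 1_D <= 1_B + 1_C] for indicator functions. *)
Lemma le_prD A B C D :
  measurable A -> measurable B -> measurable C -> measurable D ->
  A `|` D `<=` B `|` C -> A `&` D `<=` B `&` C ->
  pr P A + pr P D <= pr P B + pr P C.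
Proof.
move=> mA mB mC mD hU hI; rewrite -(pr_setUI mA mD) -(pr_setUI mB mC) lerD// le_pr//;
  by [exact: measurableU|exact: measurableI].
Qed.

Lemma pr_bigcap_eps (F : nat -> set T) (e : R) : 0 < e ->
  (forall n, measurable (F n)) -> (forall m n, (m <= n)%N -> F n `<=` F m) ->
  pr P (\bigcap_n F n) = 0 -> exists n, pr P (F n) < e.
Proof.
move=> e0 mF dF F0.
have mI : measurable (\bigcap_n F n) by exact: bigcapT_measurable.
have : P \o F @ \oo --> P (\bigcap_n F n).
  apply: nonincreasing_cvg_mu => //.
    by rewrite -ge0_fin_numE// fin_num_measure.
  by move=> m n mn; apply/subsetPset/dF.
rewrite prE// F0 => /fine_cvgP[_ /cvgr0Pnorm_lt/(_ e e0)[N _ /(_ N (leqnn N))/=]].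
by rewrite ger0_norm ?pr_ge0//; exists N.
Qed.

End RealProbability.

(** Thresholds are extended reals so that [-oo], where an almost surely finite variable has survival
    value 1, can start every sequence of thresholds. *)
Definition surv d (T : measurableType d) (R : realType) (P : probability T R)
  (Z : T -> \bar R) (x : \bar R) : R := pr P [set w | (x < Z w)%E].

Section Tail.
Context d (T : measurableType d) (R : realType) (P : probability T R).
Variable Z : T -> \bar R.
Hypothesis mZ : measurable_fun setT Z.
Implicit Types s t x : \bar R.
Local Notation S := (surv P Z).

Lemma measurable_gt x : measurable [set w | (x < Z w)%E].
Proof. by rewrite -[X in measurable X]setTI; exact: emeasurable_fun_o_infty. Qed.

Lemma measurable_lt x : measurable [set w | (Z w < x)%E].
Proof. by rewrite -[X in measurable X]setTI; exact: emeasurable_fun_infty_o. Qed.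

Lemma measurable_le x : measurable [set w | (Z w <= x)%E].
Proof. by rewrite -[X in measurable X]setTI; exact: emeasurable_fun_infty_c. Qed.

Lemma measurable_oo s t : measurable [set w | (s < Z w < t)%E].
Proof.
have -> : [set w | (s < Z w < t)%E] = [set w | (s < Z w)%E] `&` [set w | (Z w < t)%E].
  by apply/seteqP; split => w /=; [case/andP|case=> -> ->].
by apply: measurableI; [exact: measurable_gt|exact: measurable_lt].
Qed.

Lemma measurable_oc s t : measurable [set w | (s < Z w <= t)%E].
Proof.
have -> : [set w | (s < Z w <= t)%E] = [set w | (s < Z w)%E] `&` [set w | (Z w <= t)%E].
  by apply/seteqP; split => w /=; [case/andP|case=> -> ->].
by apply: measurableI; [exact: measurable_gt|exact: measurable_le].
Qed.

Lemma surv_ge0 s : 0 <= S s. Proof. exact: pr_ge0. Qed.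

Lemma surv_le1 s : S s <= 1. Proof. exact/pr_le1/measurable_gt. Qed.

Lemma le_surv s t : (s <= t)%E -> S t <= S s.
Proof.
move=> st; apply: le_pr; try exact: measurable_gt.
by move=> w /=; exact: le_lt_trans.
Qed.

Lemma surv_oc s t : (s <= t)%E -> pr P [set w | (s < Z w <= t)%E] = S s - S t.
Proof.
move=> st; rewrite -pr_setD; try exact: measurable_gt.
  congr pr; apply/seteqP; split => w /=.
    by move=> /andP[-> tw]; split => //; apply/negP; rewrite -leNgt.
  by move=> [-> /negP]; rewrite -leNgt.
by move=> w /=; exact: le_lt_trans.
Qed.

Hypothesis Z_gtNy : S -oo%E = 1.
Hypothesis Z_lty : pr P [set w | Z w = +oo%E] = 0.

Lemma surv_eps (e : R) : 0 < e -> exists t : R, S t%:E < e.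
Proof.
move=> e0.
have [||||n nP] := @pr_bigcap_eps _ _ _ P (fun n => [set w | (n%:R%:E < Z w)%E]) e.
- by [].
- by move=> n; exact: measurable_gt.
- by move=> m n mn w /=; apply: le_lt_trans; rewrite lee_fin ler_nat.
- rewrite -Z_lty; congr pr; apply/seteqP; split => w /=.
  + move=> h; case Zw : (Z w) => [r| |] //.
    * have [n rn] := ex_ltr_nat r.
      by have := h n I; rewrite /= Zw lte_fin ltNge ltW.
    * by have := h 0%N I; rewrite /= Zw ltNge leNye.
  + by move=> Zw n _ /=; rewrite Zw ltry.
by exists n%:R.
Qed.

(* Right continuity; at [-oo] this is the limit at minus infinity. *)
Lemma surv_right s (e : R) : (s < +oo)%E -> 0 < e ->
  exists2 t : R, (s < t%:E)%E & S s - e < S t%:E.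
Proof.
move=> /ex_right_seq[u [su du ux]] e0.
have [||||n nP] := @pr_bigcap_eps _ _ _ P
    (fun n => [set w | (s < Z w <= (u n)%:E)%E]) e.
- by [].
- by move=> n; exact: measurable_oc.
- move=> m n mn w /= /andP[-> /=] /le_trans; apply.
  by rewrite lee_fin du.
- rewrite -(pr_set0 P); congr pr; apply/seteqP; split => w //= h.
  have /andP[/ux[n]] := h 0%N I.
  by rewrite ltNge; have /andP[_ ->] := h n I.
exists (u n); first exact: su.
by move: nP; rewrite surv_oc ?ltW// => ?; lra.
Qed.

(** The sets where [t - 1/(n+1) < Z w < t] decrease to the empty set. The interval is open at [t],
    so an atom at [t] itself does not count. *)
Lemma surv_left (t : R) (e : R) : 0 < e ->
  exists2 s : R, s < t & pr P [set w | (s%:E < Z w < t%:E)%E] < e.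
Proof.
move=> e0.
pose u n : R := t - n.+1%:R^-1.
have [||||n nP] := @pr_bigcap_eps _ _ _ P
    (fun n => [set w | ((u n)%:E < Z w < t%:E)%E]) e.
- by [].
- by move=> n; exact: measurable_oo.
- move=> m n mn w /= /andP[+ ->]; rewrite andbT; apply: le_lt_trans.
  by rewrite lee_fin /u lerD2l lerN2 lef_pV2 ?posrE// ler_nat.
- rewrite -(pr_set0 P); congr pr; apply/seteqP; split => w //= h.
  have {}h n : ((u n)%:E < Z w < t%:E)%E := h n I.
  case: (Z w) h => [z| |] h; have /andP[] // := h 0%N.
  move=> _; rewrite lte_fin -subr_gt0 => /ex_ltr_invn[n nz].
  have /andP[+ _] := h n; rewrite lte_fin /u ltrBlDr -ltrBlDl => /lt_trans/(_ nz).
  by rewrite ltxx.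
by exists (u n) => //; rewrite /u ltrBlDr ltrDl.
Qed.

(** The interval is cut at an [x] close to [t]: []s, x]] has mass [S s - S x = 0], and []x, t[] has
    small mass by [surv_left]. *)
Lemma gap_eq0 s (t : R) :
  (forall x : R, (s <= x%:E)%E -> x < t -> S x%:E = S s) ->
  pr P [set w | (s < Z w < t%:E)%E] = 0.
Proof.
move=> h; apply/eqP; rewrite eq_le pr_ge0 andbT.
apply/ler_addgt0Pr => e e0; rewrite add0r.
have [x xt hx] := surv_left t e0.
have [xs|sx] := leP x%:E s.
  apply/ltW/(le_lt_trans _ hx); apply: le_pr; try exact: measurable_oo.
  by move=> w /= /andP[sw ->]; rewrite andbT (le_lt_trans xs).
apply: (@le_trans _ _ (pr P ([set w | (s < Z w <= x%:E)%E] `|`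
    [set w | (x%:E < Z w < t%:E)%E]))).
  apply: le_pr; [exact: measurable_oo| |].
    by apply: measurableU; [exact: measurable_oc|exact: measurable_oo].
  move=> w /= /andP[sw wt].
  by have [wx|xw] := leP (Z w) x%:E; [left; rewrite sw|right; rewrite wt].
apply: le_trans (pr_setU_le P (measurable_oc _ _) (measurable_oo _ _)) _.
by rewrite surv_oc ?(ltW sx)// (h x (ltW sx) xt) subrr add0r ltW.
Qed.

End Tail.

Lemma measurable_eray (R : realType) (x : \bar R) :
  measurable [set z : \bar R | (x < z)%E].
Proof. exact: (@measurable_gt _ _ _ id (@measurable_id _ _ setT)). Qed.

(** * The minimum of two independent variables *)

Section IndependentPair.
Context d (T : measurableType d) (R : realType) (P : probability T R).
Variables X Y : T -> \bar R.
Hypothesis mX : measurable_fun setT X.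
Hypothesis mY : measurable_fun setT Y.
Hypothesis XY : forall x y : \bar R,
  pr P [set w | (x < X w)%E && (y < Y w)%E] = surv P X x * surv P Y y.
Implicit Types s t : \bar R.
Local Notation a := (surv P X).
Local Notation b := (surv P Y).
Local Notation M := (fun w => Order.min (X w) (Y w)).

Lemma measurable_min2 : measurable_fun setT M.
Proof. exact: measurable_mine. Qed.

Lemma surv_min2 s : surv P M s = a s * b s.
Proof.
by rewrite -XY; congr pr; apply/seteqP; split => w /=; rewrite lt_min.
Qed.

Let mXY x y : measurable [set w | (x < X w)%E && (y < Y w)%E].
Proof.
have -> : [set w | (x < X w)%E && (y < Y w)%E] =
    [set w | (x < X w)%E] `&` [set w | (y < Y w)%E].
  by apply/seteqP; split => w /=; [case/andP|case=> -> ->].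
by apply: measurableI; exact: measurable_gt.
Qed.

Let mE (E : set T) s : measurable E -> measurable ([set w | (s < M w)%E] `&` E).
Proof. by move=> mE; apply: measurableI => //; exact/measurable_gt/measurable_min2. Qed.

Let mltXY : measurable [set w | (X w < Y w)%E].
Proof. by rewrite -[X in measurable X]setTI; exact: measurable_lte. Qed.

Let meqXY : measurable [set w | X w = Y w].
Proof. by rewrite -[X in measurable X]setTI; exact: measurable_eqe. Qed.

(** The left side is the probability of [s < X <= t < Y], which implies [X < Y] and [s < M <= t].
    Moving the subtracted terms across gives the form of [le_prD]. *)
Lemma lt_increment_ge s t : (s <= t)%E ->
  (a s - a t) * b t <=
  pr P ([set w | (s < M w)%E] `&` [set w | (X w < Y w)%E]) -
  pr P ([set w | (t < M w)%E] `&` [set w | (X w < Y w)%E]).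
Proof.
move=> st; rewrite mulrBl -!XY lerBlDl addrA lerBrDr.
apply: le_prD => //; try exact: mE.
- move=> w /= [/andP[sX tY]|[]].
    have [tX|Xt] := ltP t (X w); first by left; rewrite tY.
    have XY' := le_lt_trans Xt tY.
    by right; rewrite lt_min sX (lt_trans sX XY').
  by rewrite lt_min => /andP[tX tY] ?; left; rewrite tX.
- move=> w /= [/andP[sX tY] []]; rewrite !lt_min => /andP[tX _] XY'.
  by rewrite tX tY sX (le_lt_trans st tY).
Qed.

(** On [X < Y] the minimum is [X], so the increment is the probability of [s < X <= t] and [X < Y],
    which implies [s < Y]. *)
Lemma lt_increment_le s t : (s <= t)%E ->
  pr P ([set w | (s < M w)%E] `&` [set w | (X w < Y w)%E]) -
  pr P ([set w | (t < M w)%E] `&` [set w | (X w < Y w)%E]) <=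
  (a s - a t) * b s.
Proof.
move=> st; rewrite mulrBl -!XY lerBlDl addrA lerBrDr.
apply: le_prD => //; try exact: mE.
- move=> w /= [[]|/andP[tX sY]]; first by rewrite lt_min => -> _; right.
  by right; rewrite sY (le_lt_trans st tX).
- move=> w /= [[]]; rewrite !lt_min => /andP[sX sY] XY' /andP[tX _].
  by rewrite tX (lt_trans tX XY') sX.
Qed.

(** If [s < X <= t] and [X < Y], then either [X = t < Y], which the product counts, or
    [s < M < t]. *)
Lemma lt_increment_gap s t : (s <= t)%E ->
  pr P ([set w | (s < M w)%E] `&` [set w | (X w < Y w)%E]) -
  pr P ([set w | (t < M w)%E] `&` [set w | (X w < Y w)%E]) <=
  (a s - a t) * b t + pr P [set w | (s < M w < t)%E].
Proof.
move=> st; have mM := measurable_min2.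
have mO := measurable_oo mM s t.
rewrite mulrBl -!XY.
have := pr_setU_le P (mXY s t) mO.
suff : pr P ([set w | (s < M w)%E] `&` [set w | (X w < Y w)%E]) +
    pr P [set w | (t < X w)%E && (t < Y w)%E] <=
    pr P ([set w | (t < M w)%E] `&` [set w | (X w < Y w)%E]) +
    pr P ([set w | (s < X w)%E && (t < Y w)%E] `|` [set w | (s < M w < t)%E]) by lra.
apply: le_prD => //; try exact: mE; first exact: measurableU.
- move=> w /= [[]|/andP[tX tY]].
    rewrite lt_min => /andP[sX sY] XY'; right.
    have [Xt|tX] := ltP (X w) t; first by right; rewrite gt_min sX sY Xt.
    by left; rewrite sX (le_lt_trans tX XY').
  by right; left; rewrite tY (le_lt_trans st tX).
- move=> w /= [[]]; rewrite !lt_min => /andP[sX sY] XY' /andP[tX tY].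
  by split; [rewrite tX tY|left; rewrite sX].
Qed.

(** Independence is given for pairs of rays; two successive differences transfer it to a square.
    [D x] is the event [x < X], [s < Y <= t]. *)
Lemma pr_square s t : (s <= t)%E ->
  pr P [set w | (s < X w <= t)%E && (s < Y w <= t)%E] = (a s - a t) * (b s - b t).
Proof.
move=> st.
pose D x := [set w | (x < X w)%E && (s < Y w)%E] `\` [set w | (x < X w)%E && (t < Y w)%E].
have mD x : measurable (D x) by apply: measurableD.
have prD x : pr P (D x) = a x * (b s - b t).
  rewrite /D pr_setD// ?XY; first by rewrite -mulrBr.
  by move=> w /= /andP[-> /(le_lt_trans st)].
rewrite mulrBl -!prD -pr_setD//; last first.
  by move=> w [/= /andP[tX sY] h]; split => /=; rewrite (le_lt_trans st tX)// in h *;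
    move: h; rewrite tX.
congr pr; apply/seteqP; split => w; rewrite /D /=.
- move=> /andP[/andP[sX Xt] /andP[sY Yt]]; rewrite sX sY ltNge Yt ltNge Xt /=.
  by split => // -[].
- move=> [[/andP[sX sY]]]; rewrite sX sY /= => /negP; rewrite -leNgt => Yt.
  rewrite andbT (ltNge t (Y w)) Yt andbF => h.
  by rewrite andbT leNgt; apply/negP => tX; apply: h; split.
Qed.

Let mQ s t : measurable [set w | (s < X w <= t)%E && (s < Y w <= t)%E].
Proof.
have -> : [set w | (s < X w <= t)%E && (s < Y w <= t)%E] =
    [set w | (s < X w <= t)%E] `&` [set w | (s < Y w <= t)%E].
  by apply/seteqP; split => w /=; [case/andP|case=> -> ->].
by apply: measurableI; exact: measurable_oc.
Qed.

Lemma eq_increment_le s t : (s <= t)%E ->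
  pr P ([set w | (s < M w)%E] `&` [set w | X w = Y w]) -
  pr P ([set w | (t < M w)%E] `&` [set w | X w = Y w]) <=
  (a s - a t) * (b s - b t).
Proof.
move=> st; rewrite -pr_square// lerBlDl.
apply: le_trans (pr_setU_le P _ _) => //; last exact: mE.
apply: le_pr; [exact: mE|by apply: measurableU => //; exact: mE|].
move=> w /= [] + XY'; rewrite XY' minxx => sX.
by have [tY|Yt] := ltP t (Y w); [left|right; rewrite sX].
Qed.

(** Unequal values in the square have a minimum strictly below [t], so outside the gap event the
    square contains only ties. *)
Lemma eq_increment_gap s t : (s <= t)%E ->
  (a s - a t) * (b s - b t) <=
  pr P ([set w | (s < M w)%E] `&` [set w | X w = Y w]) -
  pr P ([set w | (t < M w)%E] `&` [set w | X w = Y w]) +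
  pr P [set w | (s < M w < t)%E].
Proof.
move=> st; have mM := measurable_min2.
have mO := measurable_oo mM s t.
rewrite -pr_square//.
suff : pr P [set w | (s < X w <= t)%E && (s < Y w <= t)%E] +
    pr P ([set w | (t < M w)%E] `&` [set w | X w = Y w]) <=
    pr P [set w | (s < M w < t)%E] +
    pr P ([set w | (s < M w)%E] `&` [set w | X w = Y w]) by lra.
apply: le_prD => //; try exact: mE.
- move=> w /= [/andP[/andP[sX Xt] /andP[sY Yt]]|[]].
    have [XY'|nXY] := eqVneq (X w) (Y w); first by right; rewrite XY' minxx.
    left; rewrite lt_min sX sY /= gt_min !lt_neqAle Xt Yt !andbT -negb_and.
    by apply: contra nXY => /andP[/eqP -> /eqP ->].
  move=> + XY'; rewrite XY' minxx => tY.
  by right; split => //; exact: le_lt_trans tY.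
- move=> w /= [/andP[/andP[sX Xt] _] []]; rewrite lt_min => /andP[+ _].
  by rewrite ltNge Xt.
Qed.

End IndependentPair.

(** * Survival functions of exponential and geometric type *)

Lemma le0_of_mul_invn (R : realType) (x C : R) (N : nat) :
  (forall n : nat, (N <= n)%N -> x * n%:R <= C) -> x <= 0.
Proof.
move=> h; rewrite leNgt; apply/negP => x0.
have [n nC] := ex_ltr_nat (C / x).
have := h (maxn N n) (leq_maxl _ _).
rewrite leNgt => /negP; apply; rewrite mulrC -ltr_pdivrMr//.
by rewrite (lt_le_trans nC)// ler_nat leq_maxr.
Qed.

(** The parameter [u] is [- ln S]. The increment bounds confine the growth of [- ln a] over a step
    of length [e] between [p (1 - exp (-e))] and [p (exp e - 1)]; taking [n] steps of length [v / n]
    and letting [n] grow determines [a v]. *)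
Lemma power_of_increments (R : realType) (a b : R -> R) (p : R) :
  0 <= p -> a 0 = 1 -> (forall u, 0 <= u -> 0 < a u) ->
  (forall u, 0 <= u -> a u * b u = expR (- u)) ->
  (forall u v, 0 <= u -> u <= v ->
     (a u - a v) * b v <= p * (expR (- u) - expR (- v)) <= (a u - a v) * b u) ->
  forall v, 0 < v -> a v = expR (- (p * v)).
Proof.
move=> p0 a0 apos abE inc v v0.
have step u e : 0 <= u -> 0 <= e ->
    expR (- (p * (expR e - 1))) * a u <= a (u + e) <=
    expR (- (p * (1 - expR (- e)))) * a u.
  move=> u0 e0; have ue0 : 0 <= u + e by rewrite addr_ge0.
  have /andP[lo up] : (a u - a (u + e)) * b (u + e) <=
      p * (expR (- u) - expR (- (u + e))) <= (a u - a (u + e)) * b u.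
    by apply: inc => //; rewrite lerDl.
  have au := apos u u0; have aue := apos _ ue0.
  have Eu := expR_gt0 (- u); have Ee := expR_gt0 (- e).
  have Eu' : expR (- u) = expR (- (u + e)) * expR e.
    by rewrite -expRD opprD addrNK.
  have ED : expR (- (u + e)) = expR (- u) * expR (- e) by rewrite opprD expRD.
  apply/andP; split.
    (* Multiplying by [expR (- (u + e)) = a (u + e) * b (u + e)] eliminates [b]. *)
    have : a u - a (u + e) <= p * (expR e - 1) * a (u + e).
      rewrite -(ler_pM2r (expR_gt0 (- (u + e)))).
      have -> : (a u - a (u + e)) * expR (- (u + e)) =
          (a u - a (u + e)) * b (u + e) * a (u + e) by rewrite -abE//; ring.
      have -> : p * (expR e - 1) * a (u + e) * expR (- (u + e)) =
          p * (expR (- u) - expR (- (u + e))) * a (u + e) by rewrite Eu'; ring.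
      by rewrite ler_pM2r.
    move=> h.
    have k0 : 0 <= p * (expR e - 1).
      by rewrite mulr_ge0// subr_ge0 -expR0 ler_expR.
    rewrite expRN mulrC ler_pdivrMr ?expR_gt0//.
    apply: (@le_trans _ _ (a (u + e) * (1 + p * (expR e - 1)))); first by lra.
    by rewrite ler_pM2l// expR_ge1Dx.
  have h : p * (1 - expR (- e)) * a u <= a u - a (u + e).
    rewrite -(ler_pM2r Eu).
    have -> : (a u - a (u + e)) * expR (- u) =
        (a u - a (u + e)) * b u * a u by rewrite -abE//; ring.
    have -> : p * (1 - expR (- e)) * a u * expR (- u) =
       p * (expR (- u) - expR (- (u + e))) * a u by rewrite ED; ring.
    by rewrite ler_pM2r.
  apply: (@le_trans _ _ ((1 - p * (1 - expR (- e))) * a u)); first by lra.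
  by rewrite ler_pM2r// expR_ge1Dx.
have iter e n : 0 <= e -> expR (- (n%:R * (p * (expR e - 1)))) <= a (n%:R * e) <=
    expR (- (n%:R * (p * (1 - expR (- e))))).
  move=> e0; elim: n => [|n /andP[IH1 IH2]].
    by rewrite !mul0r oppr0 expR0 a0 lexx.
  have ne0 : 0 <= n%:R * e by rewrite mulr_ge0.
  have /andP[s1 s2] := step _ _ ne0 e0.
  rewrite -natr1 !mulrDl !mul1r !opprD !expRD; apply/andP; split.
    by apply: le_trans s1; rewrite mulrC ler_pM2l ?expR_gt0.
  by apply: (le_trans s2); rewrite mulrC ler_pM2r ?expR_gt0.
pose L := - ln (a v).
have av := apos v (ltW v0).
have aE : a v = expR (- L) by rewrite /L opprK lnK// posrE.
(* For [e = v / n < 1], the inequalities [(exp e - 1) (1 - e) <= e] and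
   [e <= (1 - exp (-e)) (1 + e)] linearise the iterated bounds, so [L] and [p v] differ by at most
   [L v / n]. *)
have bnd (n : nat) : v < n%:R ->
    L * (n%:R - v) <= p * v * n%:R /\ p * v * n%:R <= L * (n%:R + v).
  move=> vn; have n0 : 0 < n%:R :> R by rewrite (lt_trans v0).
  have e0 : 0 < v / n%:R by rewrite divr_gt0.
  have e1 : v / n%:R < 1 by rewrite ltr_pdivrMr// mul1r.
  set e := v / n%:R in e0 e1.
  have nv : n%:R * e = v by rewrite /e mulrC divfK// gt_eqF.
  have /andP[] := iter e n (ltW e0); rewrite nv aE !ler_expR !lerN2 => h1 h2.
  have E1 : expR (- e) >= 1 - e by rewrite -[1 - e]/(1 + - e) expR_ge1Dx.
  have E2 : expR e >= 1 + e by rewrite expR_ge1Dx.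
  have EN : expR e * expR (- e) = 1 by rewrite -expRD subrr expR0.
  have h3 : (expR e - 1) * (1 - e) <= e.
    have : expR e * (1 - e) <= 1 by rewrite -[leRHS]EN ler_pM2l ?expR_gt0.
    by lra.
  have h4 : e <= (1 - expR (- e)) * (1 + e).
    have : (1 + e) * expR (- e) <= 1 by rewrite -[leRHS]EN ler_pM2r ?expR_gt0.
    by lra.
  have nE : n%:R - v = n%:R * (1 - e) by rewrite mulrBr mulr1 nv.
  have nE' : n%:R + v = n%:R * (1 + e) by rewrite mulrDr mulr1 nv.
  split.
    rewrite nE mulrCA [leRHS]mulrC ler_pM2l//.
    apply: (@le_trans _ _ (n%:R * (p * (expR e - 1)) * (1 - e))).
      by rewrite ler_pM2r// subr_gt0.
    rewrite -nv -!mulrA mulrCA ler_wpM2l// ler_pM2l//.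
  rewrite nE' mulrCA [leLHS]mulrC ler_pM2l//.
  apply: (@le_trans _ _ (n%:R * (p * (1 - expR (- e))) * (1 + e))); last first.
    by rewrite ler_pM2r//; lra.
  by rewrite -nv -!mulrA mulrCA !ler_wpM2l.
have [N vN] := ex_ltr_nat v.
have vn n : (N <= n)%N -> v < n%:R by move=> Nn; rewrite (lt_le_trans vN)// ler_nat.
suff -> : p * v = L by [].
apply/eqP; rewrite eq_le -(subr_le0 L) -(subr_le0 (p * v)); apply/andP; split.
  apply: (@le0_of_mul_invn _ _ (L * v) N) => n /vn/bnd[_]; lra.
apply: (@le0_of_mul_invn _ _ (L * v) N) => n /vn/bnd[+ _]; lra.
Qed.

Lemma exponential_probability (R : realType) (l : R) : 0 < l ->
  exists mu : probability (measurableTypeR R) R,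
    forall A, mu A = exponential_prob l A.
Proof.
move=> l0.
by eexists
  (exponential_distribution_exponential_prob__canonical__probability_measure_Probability l0).
Qed.

Lemma exponential_prob_set1 (R : realType) (l x : R) :
  exponential_prob l [set x] = 0%E.
Proof. by rewrite /exponential_prob integral_set1. Qed.

Lemma exponential_prob_itvoy (R : realType) (l u : R) : 0 < l -> 0 <= u ->
  exponential_prob l `]u, +oo[%classic = (expR (- (l * u)))%:E.
Proof.
move=> l0 u0.
have [mu muE] := exponential_probability l0.
have mu_neg : mu `]-oo, 0[%classic = 0%E.
  rewrite muE /exponential_prob integral0_eq// => x /=.
  by rewrite in_itv/= => x0; rewrite lt0_exponential_pdf.
have mu_cc : mu `[0, u]%classic = (1 - (expR (- (l * u)))%:E)%E.
  rewrite muE; move: u0; rewrite le_eqVlt => /predU1P[<-|u0].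
    by rewrite set_itv1 exponential_prob_set1 mulr0 oppr0 expR0 subee.
  by rewrite exponential_prob_itv0c// mulNr.
have -> : `]u, +oo[%classic = ~` (`]-oo, 0[%classic `|` `[0, u]%classic) :> set R.
  apply/seteqP; split => x /=; rewrite !in_itv/= !andbT.
    move=> ux [x0|/andP[_]]; last by rewrite leNgt ux.
    by move: (lt_trans ux x0); rewrite ltNge u0.
  move=> h; rewrite ltNge; apply/negP => xu.
  by apply: h; have [x0|x0] := ltP x 0; [left|right].
have mU : measurable (`]-oo, 0[%classic `|` `[0, u]%classic : set R).
  by apply: measurableU; exact: measurable_itv.
have muU : mu (`]-oo, 0[%classic `|` `[0, u]%classic) = (1 - (expR (- (l * u)))%:E)%E.
  rewrite -mu_cc -[RHS]add0e -mu_neg; apply: measureU => //.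
  apply/seteqP; split => x //= []; rewrite !in_itv/= => x0.
  by rewrite leNgt x0.
rewrite -muE (probability_setC mu mU) muU.
by rewrite oppeB// addeA subee// add0e.
Qed.

Lemma exponential_prob_itvcy (R : realType) (l u : R) : 0 < l -> 0 <= u ->
  exponential_prob l `[u, +oo[%classic = (expR (- (l * u)))%:E.
Proof.
move=> l0 u0; rewrite -(exponential_prob_itvoy l0 u0).
have [mu muE] := exponential_probability l0.
have -> : `[u, +oo[%classic = [set u] `|` `]u, +oo[%classic.
  by rewrite (@setU1itv _ _ +oo%O u false).
rewrite -!muE; have <- : (mu [set u] + mu `]u, +oo[%classic = mu `]u, +oo[%classic)%E.
  by rewrite [mu [set u]]muE exponential_prob_set1 add0e.
apply: measureU => //.
by apply/seteqP; split => x //= [->]; rewrite in_itv/= ltxx.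
Qed.

Lemma ereal_measure_unique (R : realType)
    (m1 m2 : {measure set (\bar R) -> \bar R}) :
  m1 setT = m2 setT -> (m1 setT < +oo)%E ->
  (forall t : R, m1 [set x | (t%:E < x)%E] = m2 [set x | (t%:E < x)%E]) ->
  forall A, measurable A -> m1 A = m2 A.
Proof.
move=> mT mfin mray A mA.
(* Rays with a real endpoint omit [-oo] and do not cover the space; adjoining [setT] keeps the class
   closed under intersection and lets a constant sequence exhaust the space. *)
pose G : set (set (\bar R)) := [set B | B = setT \/ ErealGenOInfty.G B].
apply: (measure_unique G (fun=> setT)) => //.
- rewrite [LHS](ErealGenOInfty.measurableE R); apply/seteqP; split.
    by apply: sub_sigma_algebra2 => B GB; right.
  apply: smallest_sub; first exact: sigma_algebra_measurable.
  move=> B [->|GB]; first exact: measurableT.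
  exact: sub_sigma_algebra.
- move=> B C [->|[s ->]] [->|[t ->]].
  + by left; rewrite setIT.
  + by right; exists t; rewrite setTI.
  + by right; exists s; rewrite setIT.
  + right; exists (Num.max s t); apply/seteqP; split => x /=;
      rewrite !in_itv/= !andbT EFin_max gt_max; first by case=> -> ->.
    by case/andP.
- by move=> k; left.
- by apply/seteqP; split => // x _; exists 0%N.
- move=> B [->//|[t ->]].
  have -> : `]t%:E, +oo[%classic = [set x : \bar R | (t%:E < x)%E].
    by apply/seteqP; split => x /=; rewrite in_itv/= andbT.
  exact: mray.
Qed.

(** * Images of an exponential law under an increasing function *)

Section ExponentialLaw.
Context d (T : measurableType d) (R : realType) (P : probability T R).
Variables (X : {RV P >-> \bar R}) (g : R -> R).
Hypothesis g_incr : increasing_on_pos g.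

(** The value [-oo] removes the nonpositive reals from the preimage of every ray. That preimage is
    an interval because [g] increases, whence the measurability of [f]. *)
Let f (v : R) : \bar R := if 0 < v then (g v)%:E else -oo%E.

Let f_ray (t : R) : [set v : R | (t%:E < f v)%E] = [set v | 0 < v /\ t < g v].
Proof.
apply/seteqP; split => v /=; rewrite /f.
  by case: ifPn => // v0; rewrite lte_fin.
by move=> [-> tg]; rewrite lte_fin.
Qed.

Let mf : measurable_fun [set: R] f.
Proof.
apply: (measurability (@ErealGenOInfty.G R)).
  exact: ErealGenOInfty.measurableE.
move=> _ [_ [t ->]] <-; rewrite setTI.
have -> : f @^-1` `]t%:E, +oo[ = [set v | 0 < v /\ t < g v].
  by rewrite -f_ray; apply/seteqP; split => x /=; rewrite in_itv/= andbT.
apply: is_interval_measurable => x y /= [x0 tx] _ z /andP[xz _].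
split; first exact: lt_le_trans xz.
move: xz; rewrite le_eqVlt => /predU1P[<-//|xz].
exact: lt_trans (g_incr x0 xz).
Qed.

Lemma measurable_pos_preimage (A : set (\bar R)) : measurable A ->
  measurable [set v : R | 0 < v /\ A (g v)%:E].
Proof.
move=> mA.
have -> : [set v : R | 0 < v /\ A (g v)%:E] = `]0, +oo[%classic `&` (f @^-1` A).
  apply/seteqP; split => v /=; rewrite in_itv/= andbT /f.
    by move=> [v0 Av]; rewrite v0.
  by move=> [v0]; rewrite v0.
apply: measurableI => //; rewrite -[X in measurable X]setTI; exact: mf.
Qed.

(** The law of [X] and the image [nu] of the exponential law under [f] are finite measures, so
    agreement on open rays suffices. *)
Lemma g_exponential_of_surv (l : R) : 0 < l ->
  (forall t : R, (surv P X t%:E)%:E =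
     exponential_prob l [set v : R | 0 < v /\ t < g v]) ->
  g_exponential g X.
Proof.
move=> l0 h; exists l => // A mA.
have [mu muE] := exponential_probability l0.
pose nu := measure_function_pushforward__canonical__measure_function_Measure mu mf.
(* When [A] contains [-oo], its preimage under [f] also contains the nonpositive reals; these have
   exponential mass 0. *)
have -> : exponential_prob l [set v : R | (0 < v)%R /\ A (g v)%:E] = nu A.
  have npos : mu `]-oo, 0]%classic = 0%E.
    have -> : `]-oo, 0]%classic = ~` `]0, +oo[%classic :> set R by rewrite setCitvr.
    rewrite probability_setC//.
    by rewrite muE exponential_prob_itvoy// mulr0 oppr0 expR0 subee.
  rewrite -muE -[RHS]/(mu (f @^-1` A)).
  have mfA : measurable (f @^-1` A) by rewrite -[X in measurable X]setTI; exact: mf.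
  rewrite -(setIT (f @^-1` A)) -(setUv `]0, +oo[%classic) setIUr measureU//; last 3 first.
  - by apply: measurableI.
  - by apply: measurableI => //; exact: measurableC.
  - by rewrite setIACA setICr setI0.
  rewrite [X in (_ + X)%E](_ : _ = 0%E) ?adde0; last first.
    apply/eqP; rewrite -measure_le0 -npos; apply: le_measure; rewrite ?inE//.
    + by apply: measurableI => //; exact: measurableC.
    + by rewrite setCitvr.
  congr (mu _); apply/seteqP; split => v /=; rewrite in_itv/= andbT /f.
    by move=> [v0 Av]; rewrite v0.
  by move=> [+ v0]; rewrite v0.
apply: ereal_measure_unique => //.
- rewrite [LHS](probability_setT (distribution P X)).
  by rewrite -[RHS]/(mu (f @^-1` setT)) preimage_setT probability_setT.
- by rewrite [ltLHS](probability_setT (distribution P X)) ltry.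
- move=> t; rewrite -[RHS]/(mu [set v | (t%:E < f v)%E]) f_ray muE -h.
  by rewrite /surv -prE//; exact: measurable_gt.
Qed.

Lemma surv_of_g_exponential (l : R) : 0 < l ->
  (forall A : set (\bar R), measurable A ->
      distribution P X A =
      exponential_prob l [set v : R | (0 < v)%R /\ A (g v)%:E]) ->
  forall t : \bar R, (surv P X t)%:E =
     exponential_prob l [set v : R | 0 < v /\ (t < (g v)%:E)%E].
Proof.
move=> l0 h t; rewrite -(h [set x | (t < x)%E]); last exact: measurable_eray.
by rewrite /surv -prE//; exact: measurable_gt.
Qed.

End ExponentialLaw.

Lemma ex_expr_lt (R : realType) (x e : R) : 0 <= x < 1 -> 0 < e ->
  exists n : nat, x ^+ n < e.
Proof.
move=> /andP[x0 x1] e0.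
have nx : `|x| < 1 by rewrite ger0_norm.
have /cvgr0Pnorm_lt/(_ e e0)[N _ /(_ N (leqnn N))/=] := cvg_geometric 1 nx.
by rewrite mul1r ger0_norm ?exprn_ge0//; exists N.
Qed.

Lemma le0_of_expr_bound (R : realType) (x y : R) : 0 <= x < 1 ->
  (forall n : nat, y <= x ^+ n) -> y <= 0.
Proof.
move=> x01 h; rewrite leNgt; apply/negP => /(ex_expr_lt x01)[n].
by rewrite ltNge h.
Qed.

(* Starting at [-oo] makes [surv P X (atom_seq g k) = x ^+ k] hold from [k = 0] on. *)
Definition atom_seq (R : realType) (g : R -> R) (k : nat) : \bar R :=
  if k is k'.+1 then (g k%:R)%:E else -oo%E.
Arguments atom_seq {R} g k : simpl never.

Section AtomSeq.
Context (R : realType) (g : R -> R).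
Hypothesis g_incr : increasing_on_pos g.

Lemma atom_seq_ltS k : (atom_seq g k < atom_seq g k.+1)%E.
Proof.
case: k => [|k]; rewrite /atom_seq; first by rewrite ltNyr.
by rewrite lte_fin g_incr ?ltr0n// ltr_nat.
Qed.

Lemma atom_seq_le : {homo atom_seq g : j k / (j <= k)%N >-> (j <= k)%E}.
Proof. by apply: homo_leq => [//|y x z|k]; [exact: le_trans|exact/ltW/atom_seq_ltS]. Qed.

Lemma atom_seq_inj : injective (atom_seq g).
Proof.
have lt j k : (j < k)%N -> (atom_seq g j < atom_seq g k)%E.
  by move=> /atom_seq_le; apply: lt_le_trans; exact: atom_seq_ltS.
move=> j k jk; apply/eqP; rewrite eqn_leq (leqNgt j) (leqNgt k); apply/andP; split;
  by apply/negP => /lt; rewrite jk ltxx.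
Qed.

End AtomSeq.

(** * Images of a geometric law under an increasing function *)

Section GeometricLaw.
Context d (T : measurableType d) (R : realType) (P : probability T R).
Variables (X : {RV P >-> \bar R}) (g : R -> R) (x : R).
Hypothesis g_incr : increasing_on_pos g.
Hypothesis x01 : 0 < x < 1.
Local Notation t := (atom_seq g).

Let mX : measurable_fun setT X. Proof. by []. Qed.

Let mXeq (y : \bar R) : measurable [set w | X w = y].
Proof.
rewrite -[X in measurable X]setTI.
by have -> : [set w | X w = y] = X @^-1` [set y] by []; exact: mX.
Qed.

(** Each [t k.+1] is an atom of mass [x ^+ k - x ^+ k.+1]. Nothing else has mass: the gaps below
    [t k] are null, and [X] exceeds [t k] with probability [x ^+ k], which tends to 0. *)
Lemma g_geometric_of_surv : (forall k, surv P X (t k) = x ^+ k) ->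
  (forall k, pr P [set w | (t k < X w < t k.+1)%E] = 0) ->
  g_geometric g X.
Proof.
move=> hS hgap; have /andP[x0 x1] := x01.
exists (1 - x); first by rewrite subr_gt0 x1 ltrBlDr ltrDl.
move=> A mA.
have mt k := measurable_oo mX (t k) (t k.+1).
have atom k : pr P [set w | X w = t k.+1] = (1 - x) * x ^+ k.
  have -> : (1 - x) * x ^+ k = surv P X (t k) - surv P X (t k.+1) - 0.
    by rewrite !hS exprS; ring.
  have tt := atom_seq_ltS g_incr k.
  rewrite -surv_oc ?(ltW tt)// -(hgap k) -pr_setD//.
  - congr pr; apply/seteqP; split => w /=.
      by move=> ->; rewrite tt lexx ltxx andbF.
    move=> [/andP[-> /=]]; rewrite le_eqVlt => /predU1P[//|->].
    by move=> /(_ isT).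
  - exact: measurable_oc.
  - by move=> w /= /andP[-> /ltW].
pose D := \bigcup_k [set w | X w = t k.+1].
have mD : measurable D by exact: bigcupT_measurable.
have mND : measurable (~` D) by exact: measurableC.
have null k : pr P (~` D `&` [set w | (X w <= t k)%E]) = 0.
  have mle j : measurable (~` D `&` [set w | (X w <= t j)%E]).
    by apply: measurableI => //; exact: measurable_le.
  elim: k => [|k IH]; apply/eqP; rewrite eq_le pr_ge0 andbT.
    have <- : pr P (~` [set w | (t 0%N < X w)%E]) = 0.
      rewrite pr_setC; last exact: measurable_gt.
      by rewrite -[pr P _]/(surv P X _) hS expr0 subrr.
    apply: le_pr => //; first by apply: measurableC; exact: measurable_gt.
    by move=> w /= [_]; rewrite leNgt => /negP.
  rewrite -[leRHS](addr0 0) -{1}IH -(hgap k).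
  apply: le_trans (pr_setU_le P (mle k) (mt k)); apply: le_pr => //.
    exact: measurableU.
  move=> w /= [Dw]; rewrite le_eqVlt => /predU1P[e|wt].
    by exfalso; apply: Dw; exists k.
  by have [tw|wt'] := ltP (t k) (X w); [right; rewrite wt|left].
have PD : P (~` D) = 0%E.
  rewrite prE//; congr EFin; apply/eqP; rewrite eq_le pr_ge0 andbT.
  apply: (@le0_of_expr_bound _ x); first by rewrite ltW.
  move=> k; rewrite -hS -[leRHS]add0r -(null k).
  apply: le_trans (pr_setU_le P _ _); try exact: measurable_gt; last first.
    by apply: measurableI => //; exact: measurable_le.
  apply: le_pr => //.
    apply: measurableU; last exact: measurable_gt.
    by apply: measurableI => //; exact: measurable_le.
  by move=> w Dw /=; have [tw|wt] := ltP (t k) (X w); [right|left].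
have mXA : measurable (X @^-1` A) by rewrite -[X in measurable X]setTI; exact: mX.
rewrite /distribution /pushforward -(setIT (X @^-1` A)) -(setUv D) setIUr measureU//;
  [|exact: measurableI|exact: measurableI|by rewrite setIACA setICr setI0].
rewrite [X in (_ + X)%E](_ : _ = 0%E) ?adde0; last first.
  apply/eqP; rewrite -measure_le0 -PD; apply: le_measure; rewrite ?inE//.
  exact: measurableI.
pose K := [set k : nat | (0 < k)%N /\ A (g k%:R)%:E].
have -> : X @^-1` A `&` D = \bigcup_(k in K) [set w | X w = t k].
  apply/seteqP; split => w /=.
    move=> [AX [k _ /= Xw]]; exists k.+1 => //.
    by split => //; rewrite -[(g _)%:E]/(t k.+1) -Xw.
  move=> [[|k] [//= _ Ak] /= Xw]; split; last by exists k.
  by rewrite /preimage /= Xw.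
have tK : trivIset K (fun k => [set w | X w = t k]).
  by move=> j k _ _ [w [/= -> /(atom_seq_inj g_incr)]].
apply: etrans; first by apply: measure_bigcup => // k _; exact: mXeq.
rewrite nneseries_esum//.
have -> : [set k | k \in K] = K by apply/seteqP; split => k /=; rewrite inE.
rewrite /geometric_prob; apply: eq_esum => -[|k] [//= _ _].
by rewrite prE// atom/= subKr.
Qed.

(** Among the values of [g] at positive integers, []t k, t k.+1]] contains only the one at [k.+1],
    so the survival function drops by [(1 - x) * x ^+ k] at each step. *)
Lemma surv_of_g_geometric :
  (forall A : set (\bar R), measurable A ->
      distribution P X A =
      geometric_prob (1 - x) [set k : nat | (0 < k)%N /\ A (g k%:R)%:E]) ->
  (forall k, surv P X (t k) = x ^+ k) /\
  (forall y : \bar R, (surv P X y)%:E =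
     geometric_prob (1 - x) [set k : nat | (0 < k)%N /\ (y < (g k%:R)%:E)%E]).
Proof.
move=> h.
have pmf_ge0 k : (0 <= (geometric_pmf (1 - x) k)%:E)%E.
  have /andP[x0 x1] := x01; case: k => [|k] //=.
  by rewrite lee_fin subKr mulr_ge0 ?exprn_ge0 ?subr_ge0 ?ltW.
have prX A : measurable A -> (pr P (X @^-1` A))%:E =
    geometric_prob (1 - x) [set k : nat | (0 < k)%N /\ A (g k%:R)%:E].
  move=> mA; rewrite -h// /distribution /pushforward prE//.
  by rewrite -[X in measurable X]setTI; exact: mX.
have lt j k : (atom_seq g j < atom_seq g k)%E = (j < k)%N.
  apply/idP/idP => [jk|jk]; last first.
    by apply: (lt_le_trans (atom_seq_ltS g_incr j)); exact: atom_seq_le.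
  by rewrite ltnNge; apply/negP => /(atom_seq_le g_incr); rewrite leNgt jk.
have le j k : (atom_seq g j <= atom_seq g k)%E = (j <= k)%N.
  by rewrite leNgt lt -leqNgt.
split=> [k|y]; last first.
  by rewrite -(prX [set z | (y < z)%E])//; exact: measurable_eray.
elim: k => [|k IH].
  have Ny : pr P (X @^-1` [set -oo%E]) = 0.
    apply/EFin_inj; rewrite prX//.
    rewrite /geometric_prob [X in \esum_(_ in X) _](_ : _ = set0) ?esum_set0//.
    by apply/seteqP; split => j //= [].
  rewrite expr0 -[RHS]subr0 -Ny -pr_setC; last exact: mXeq.
  congr pr; apply/seteqP; split => w /=.
    by move=> + Xw; rewrite Xw ltxx.
  by move=> Xw; rewrite ltNye; apply/eqP.
have : surv P X (t k) - surv P X (t k.+1) = (1 - x) * x ^+ k.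
  rewrite -surv_oc//; last exact/ltW/atom_seq_ltS.
  apply/EFin_inj.
  have -> : [set w | (t k < X w <= t k.+1)%E] = X @^-1` `]t k, t k.+1].
    by apply/seteqP; split => w /=; rewrite in_itv.
  rewrite prX; last exact: emeasurable_itv.
  rewrite /geometric_prob [X in \esum_(_ in X) _](_ : _ = [set k.+1]).
    by rewrite esum_set1 ?pmf_ge0//= subKr.
  apply/seteqP; split => [[|j] [//= _]|_ ->] /=; rewrite in_itv/=.
    rewrite -[(g _)%:E]/(t j.+1) lt le !ltnS => kj.
    by congr S; apply/eqP; rewrite eqn_leq andbC.
  by split => //; rewrite -[(g _)%:E]/(t k.+1) (atom_seq_ltS g_incr) /=.
by rewrite IH exprS; lra.
Qed.

End GeometricLaw.

(** * From independence to a common law *)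

(* [a] and [b] stand for the survival functions of two independent variables,
   [S] for that of their minimum M, [gap s t] for P(s < M < t), and [p], [q],
   [r] for the probabilities that the first variable is smaller, larger, tied. *)
Record cause_rates (R : realType) (S a b : \bar R -> R)
    (gap : \bar R -> \bar R -> R) (p q r : R) : Prop := {
  ratesM : forall s, S s = a s * b s;
  lt_rate_ge : forall s t, (s <= t)%E -> (a s - a t) * b t <= p * (S s - S t);
  lt_rate_le : forall s t, (s <= t)%E -> p * (S s - S t) <= (a s - a t) * b s;
  lt_rate_gap : forall s t, (s <= t)%E ->
    p * (S s - S t) <= (a s - a t) * b t + gap s t;
  gt_rate_ge : forall s t, (s <= t)%E -> (b s - b t) * a t <= q * (S s - S t);
  gt_rate_le : forall s t, (s <= t)%E -> q * (S s - S t) <= (b s - b t) * a s;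
  gt_rate_gap : forall s t, (s <= t)%E ->
    q * (S s - S t) <= (b s - b t) * a t + gap s t;
  eq_rate_le : forall s t, (s <= t)%E ->
    r * (S s - S t) <= (a s - a t) * (b s - b t);
  eq_rate_gap : forall s t, (s <= t)%E ->
    (a s - a t) * (b s - b t) <= r * (S s - S t) + gap s t }.

Definition indep_tail d (T : measurableType d) (R : realType)
    (P : probability T R) (Z : T -> \bar R) (E : set T) : Prop :=
  forall t, pr P ([set w | (t < Z w)%E] `&` E) = surv P Z t * pr P E.

Section PairRates.
Context d (T : measurableType d) (R : realType) (P : probability T R).
Variables X Y : T -> \bar R.
Hypothesis mX : measurable_fun setT X.
Hypothesis mY : measurable_fun setT Y.
Hypothesis XY : forall x y : \bar R,
  pr P [set w | (x < X w)%E && (y < Y w)%E] = surv P X x * surv P Y y.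

Lemma indep_pairC (x y : \bar R) :
  pr P [set w | (x < Y w)%E && (y < X w)%E] = surv P Y x * surv P X y.
Proof. by rewrite mulrC -XY; under eq_set do rewrite andbC. Qed.

(** Independence turns each increment of [P(t < M, E)] into [P(E)] times that of [S]; the [gt]
    bounds are the [lt] bounds with [X] and [Y] exchanged. Naming [M] by an equation allows both
    orders of the minimum. *)
Lemma cause_rates_of_indep (M : T -> \bar R) :
  M = (fun w => Order.min (X w) (Y w)) ->
  indep_tail P M [set w | (X w < Y w)%E] ->
  indep_tail P M [set w | (Y w < X w)%E] ->
  indep_tail P M [set w | X w = Y w] ->
  cause_rates (surv P M) (surv P X) (surv P Y)
    (fun s t => pr P [set w | (s < M w < t)%E])
    (pr P [set w | (X w < Y w)%E]) (pr P [set w | (Y w < X w)%E])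
    (pr P [set w | X w = Y w]).
Proof.
move=> MXY Ilt Igt Ieq.
have MYX : M = fun w => Order.min (Y w) (X w).
  by rewrite MXY; apply/funext => w; rewrite minC.
have inc E s t : indep_tail P M E -> pr P E * (surv P M s - surv P M t) =
    pr P ([set w | (s < M w)%E] `&` E) - pr P ([set w | (t < M w)%E] `&` E).
  by move=> IE; rewrite !IE -mulrBl mulrC.
split=> [s|s t st|s t st|s t st|s t st|s t st|s t st|s t st|s t st].
- by rewrite MXY; exact: surv_min2.
- by rewrite inc// MXY; exact: lt_increment_ge.
- by rewrite inc// MXY; exact: lt_increment_le.
- by rewrite inc// MXY; exact: lt_increment_gap.
- by rewrite inc// MYX; exact: (lt_increment_ge mY mX indep_pairC).
- by rewrite inc// MYX; exact: (lt_increment_le mY mX indep_pairC).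
- by rewrite inc// MYX; exact: (lt_increment_gap mY mX indep_pairC).
- by rewrite inc// MXY; exact: eq_increment_le.
- by rewrite inc// MXY; exact: eq_increment_gap.
Qed.

End PairRates.

(** * The case without ties: a minimum with continuous survival function *)

Section Quantile.
Context d (T : measurableType d) (R : realType) (P : probability T R).
Variable Z : T -> \bar R.
Hypothesis mZ : measurable_fun setT Z.
Hypothesis Z_gtNy : surv P Z -oo%E = 1.
Hypothesis Z_lty : pr P [set w | Z w = +oo%E] = 0.
Local Notation S := (surv P Z).
Local Notation gap s t := (pr P [set w | (s < Z w < t)%E]).

Definition quantile (v : R) : R := inf [set t : R | S t%:E <= expR (- v)].

(** The set is nonempty because [S] tends to 0, and bounded below because [S] tends to
    [1 > expR (- v)] at minus infinity. *)
Let has_inf_quantile (v : R) : 0 < v -> has_inf [set t : R | S t%:E <= expR (- v)].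
Proof.
move=> v0; split.
  have [t St] := surv_eps mZ Z_lty (expR_gt0 (- v)).
  by exists t; exact: ltW.
have e0 : 0 < 1 - expR (- v) by rewrite subr_gt0 expR_lt1 oppr_lt0.
have [t _ St] := surv_right P mZ (isT : (-oo < +oo)%E) e0.
exists t => u /= uv; rewrite leNgt; apply/negP => ut.
have : S t%:E <= S u%:E by apply: le_surv => //; rewrite lee_fin ltW.
by move: St uv; rewrite Z_gtNy; lra.
Qed.

(** Right continuity of [S] makes the infimum a minimum; this is the Galois connection between
    [quantile] and [S]. *)
Lemma quantile_le v t : 0 < v -> (quantile v <= t) = (S t%:E <= expR (- v)).
Proof.
move=> v0; have [h1 h2] := has_inf_quantile v0.
apply/idP/idP => [gt|St]; last exact: ge_inf.
have St : S t%:E <= S (quantile v)%:E by apply: le_surv => //; rewrite lee_fin.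
apply: (le_trans St); rewrite leNgt; apply/negP => hS.
have e0 : 0 < S (quantile v)%:E - expR (- v) by rewrite subr_gt0.
have [u] := surv_right P mZ (ltry (quantile v)) e0.
rewrite lte_fin opprB addrC addrNK => /(inf_lt h1)[x /= Sx xu].
have : S u%:E <= S x%:E by apply: le_surv => //; rewrite lee_fin ltW.
by move=> ux; rewrite ltNge (le_trans ux).
Qed.

Hypothesis no_jump : exists2 c : R, 0 < c & forall s t : R, s < t ->
  c * (S s%:E - S t%:E) ^+ 2 <= gap s%:E t%:E.

(** If [S] fell short of [expR (- v)] by [e] at the quantile, every gap just below it would have
    mass at least [c * e ^+ 2] by [no_jump], against [surv_left]. *)
Lemma surv_quantile v : 0 < v -> S (quantile v)%:E = expR (- v).
Proof.
move=> v0; apply/eqP; rewrite eq_le -quantile_le// lexx /=.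
have [c c0 hc] := no_jump.
rewrite leNgt; apply/negP => hS.
set e := expR (- v) - S (quantile v)%:E.
have e0 : 0 < e by rewrite subr_gt0.
have ce0 : 0 < c * e ^+ 2 by rewrite mulr_gt0// exprn_gt0.
have [s sq gs] := surv_left P mZ (quantile v) ce0.
have Ss : expR (- v) < S s%:E by rewrite ltNge -quantile_le// -ltNge.
have eD : e <= S s%:E - S (quantile v)%:E by rewrite lerD2r ltW.
have : c * e ^+ 2 <= c * (S s%:E - S (quantile v)%:E) ^+ 2.
  by rewrite ler_pM2l// ler_pXn2r// nnegrE ltW// (lt_le_trans e0).
by move=> /(lt_le_trans gs); rewrite ltNge hc.
Qed.

Lemma quantile_increasing : increasing_on_pos quantile.
Proof.
move=> v w v0 vw; have w0 := lt_trans v0 vw.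
by rewrite ltNge quantile_le// surv_quantile// ler_expR lerN2 -ltNge.
Qed.

End Quantile.

Section ForwardExponential.
Context d (T : measurableType d) (R : realType) (P : probability T R).
Variable Z : T -> \bar R.
Hypothesis mZ : measurable_fun setT Z.
Hypothesis Z_gtNy : surv P Z -oo%E = 1.
Hypothesis Z_lty : pr P [set w | Z w = +oo%E] = 0.
Local Notation S := (surv P Z).
Local Notation gap := (fun s t => pr P [set w | (s < Z w < t)%E]).

(** With tie rate 0 the gap dominates the product of the increments of the two survival functions.
    These are at least [p] and [q] times that of [S], since survival values are at most 1. *)
Lemma no_jump_of_rates (X Y : T -> \bar R) (p q : R) :
  measurable_fun setT X -> measurable_fun setT Y -> 0 < p -> 0 < q ->
  cause_rates S (surv P X) (surv P Y) gap p q 0 ->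
  forall s t : R, s < t -> p * q * (S s%:E - S t%:E) ^+ 2 <= gap s%:E t%:E.
Proof.
move=> mX mY p0 q0 H s t st.
have st' : (s%:E <= t%:E)%E by rewrite lee_fin ltW.
have := eq_rate_gap H st'; rewrite mul0r add0r; apply: le_trans.
have D0 : 0 <= S s%:E - S t%:E by rewrite subr_ge0 le_surv.
have pD0 : 0 <= p * (S s%:E - S t%:E) by rewrite mulr_ge0// ltW.
have qD0 : 0 <= q * (S s%:E - S t%:E) by rewrite mulr_ge0// ltW.
have Da : p * (S s%:E - S t%:E) <= surv P X s%:E - surv P X t%:E.
  apply: le_trans (lt_rate_le H st') _.
  by rewrite ler_piMr ?surv_le1// subr_ge0 le_surv.
have Db : q * (S s%:E - S t%:E) <= surv P Y s%:E - surv P Y t%:E.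
  apply: le_trans (gt_rate_le H st') _.
  by rewrite ler_piMr ?surv_le1// subr_ge0 le_surv.
by rewrite expr2 mulrACA ler_pM.
Qed.

Hypothesis no_jump : exists2 c : R, 0 < c & forall s t : R, s < t ->
  c * (S s%:E - S t%:E) ^+ 2 <= gap s%:E t%:E.

(** Along the quantiles [S] is [expR (- v)], so [power_of_increments] applies and the rate is [p].
    The quantile depends on [Z] alone, hence is common to all [X]. *)
Lemma g_exponential_quantile (X : {RV P >-> \bar R}) (Y : T -> \bar R) (p q r : R) :
  measurable_fun setT Y -> 0 < p ->
  cause_rates S (surv P X) (surv P Y) gap p q r ->
  g_exponential (quantile P Z) X.
Proof.
move=> mY p0 H; pose a := surv P X; pose b := surv P Y.
have mX : measurable_fun setT X by [].
have aNy : a -oo%E = 1.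
  have := ratesM H -oo%E; rewrite Z_gtNy -/a -/b => e.
  apply/eqP; rewrite eq_le surv_le1//= e ler_piMr//; first exact: surv_ge0.
  exact: surv_le1.
(* Where [S] is constant and positive, [a] is constant too: [(a s - a t) * b t <= 0] and
   [b t > 0]. *)
have eqS s t : (s <= t)%E -> S s = S t -> 0 < S s -> a s = a t.
  move=> st Sst S0; apply/eqP; rewrite eq_le; apply/andP; split; last exact: le_surv.
  have := lt_rate_ge H st; rewrite Sst subrr mulr0 pmulr_lle0 ?subr_le0//.
  have := ratesM H t; rewrite -Sst => e.
  rewrite lt_neqAle surv_ge0 andbT; apply/eqP => b0'.
  by move: S0; rewrite e -b0' mulr0 ltxx.
pose tv (v : R) : \bar R := if 0 < v then (quantile P Z v)%:E else -oo%E.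
have tv_le (u v : R) : 0 <= u -> u <= v -> (tv u <= tv v)%E.
  rewrite /tv; case: ifPn => [u0 _|]; last by rewrite leNye.
  rewrite le_eqVlt => /predU1P[<-|uv].
    by rewrite u0.
  by rewrite (lt_trans u0 uv) lee_fin ltW//; exact: quantile_increasing.
have Stv (v : R) : 0 <= v -> S (tv v) = expR (- v).
  rewrite le_eqVlt => /predU1P[<-|v0].
    by rewrite /tv ltxx Z_gtNy oppr0 expR0.
  by rewrite /tv v0 surv_quantile.
have aq (v : R) : 0 < v -> a (quantile P Z v)%:E = expR (- (p * v)).
  move=> v0; have -> : (quantile P Z v)%:E = tv v by rewrite /tv v0.
  apply: (@power_of_increments _ (a \o tv) (b \o tv)) => //=.
  - exact: ltW.
  - by rewrite /tv ltxx.
  - move=> u u0; rewrite lt_neqAle surv_ge0 andbT; apply/eqP => a0.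
    have := ratesM H (tv u); rewrite Stv// -[surv P X _]/(a _) -a0 mul0r => e.
    by have := expR_gt0 (- u); rewrite e ltxx.
  - by move=> u u0; rewrite -Stv// (ratesM H).
  - move=> u w u0 uw; have tuw := tv_le _ _ u0 uw.
    have w0 := le_trans u0 uw.
    rewrite -!Stv//; apply/andP; split.
      exact: lt_rate_ge H _ _ tuw.
    exact: lt_rate_le H _ _ tuw.
apply: (g_exponential_of_surv (quantile_increasing mZ Z_gtNy Z_lty no_jump) p0) => t.
rewrite -/(a _).
have -> : [set v | 0 < v /\ t < quantile P Z v] = [set v | 0 < v /\ expR (- v) < S t%:E].
  have e v : 0 < v -> (t < quantile P Z v) = (expR (- v) < S t%:E).
    by move=> v0; rewrite ltNge quantile_le// -ltNge.
  by apply/seteqP; split => v /= [v0]; rewrite ?e// => h; split; rewrite ?e.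
(* If [S t = 0], then [t] is above every quantile, and [a t <= expR (- (p * n%:R))] for all [n >= 1]
   forces [a t = 0]. The product formula alone would not do, as [b t] may be the vanishing
   factor. *)
have := surv_ge0 P Z t%:E; rewrite le_eqVlt => /predU1P[S0|S0].
  have -> : [set v : R | 0 < v /\ expR (- v) < S t%:E] = set0.
    apply/seteqP; split => v //= [_]; rewrite -S0 ltNge => /negP; apply.
    exact: expR_ge0.
  have [mu muE] := exponential_probability p0.
  rewrite -muE measure0; congr EFin; apply/eqP; rewrite eq_le surv_ge0 andbT.
  apply: (@le0_of_mul_invn _ _ p^-1 1) => n n1.
  have n0 : 0 < n%:R :> R by rewrite ltr0n.
  rewrite -[leRHS]mul1r ler_pdivlMr//.
  have : a t%:E <= expR (- (p * n%:R)).
    rewrite -aq//; apply: le_surv => //.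
    by rewrite lee_fin quantile_le// -S0 expR_ge0.
  rewrite expRN => h.
  have : expR (p * n%:R) >= p * n%:R by apply: le_trans (expR_ge1Dx _); rewrite lerDr.
  move=> h'; apply: (@le_trans _ _ ((expR (p * n%:R))^-1 * expR (p * n%:R))).
    rewrite -mulrA [_ * p]mulrC ler_pM//; first exact: surv_ge0.
    by rewrite mulr_ge0 ?ltW.
  by rewrite mulVf// gt_eqF// expR_gt0.
(* [S] has the same positive value at [t] and at the quantile of [u], so [eqS] identifies the values
   of [a]; for [u = 0] the comparison is with [-oo]. *)
pose u := - ln (S t%:E).
have Su : S t%:E = expR (- u) by rewrite opprK lnK.
have u0 : 0 <= u by rewrite -oppr_le0 -expR_le1 -Su surv_le1.
have -> : [set v : R | 0 < v /\ expR (- v) < S t%:E] = `]u, +oo[%classic.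
  apply/seteqP; split => v /=; rewrite in_itv/= andbT Su ltr_expR ltrN2.
    by case.
  by move=> uv; split => //; exact: le_lt_trans uv.
rewrite exponential_prob_itvoy//; congr EFin.
move: u0; rewrite le_eqVlt => /predU1P[u0|u0].
  rewrite -u0 mulr0 oppr0 expR0 -aNy; apply/esym/eqS; rewrite ?leNye//.
    by rewrite Z_gtNy Su -u0 oppr0 expR0.
  by rewrite Z_gtNy.
rewrite -aq//; have Sq : S (quantile P Z u)%:E = S t%:E by rewrite surv_quantile.
by apply/esym/eqS; rewrite ?Sq// lee_fin quantile_le// Su.
Qed.

End ForwardExponential.

(** Linear interpolation between integers, with [e k] placed at [k.+1]; the value [e 0 - 1] placed
    at 0 makes the function increase on []0, 1[] as well. *)
Lemma increasing_extension (R : realType) (e : nat -> R) :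
  (forall k, e k < e k.+1) ->
  exists2 g : R -> R, increasing_on_pos g & forall k, g k.+1%:R = e k.
Proof.
move=> eS; pose h k := if k is k'.+1 then e k' else e 0%N - 1.
have hS k : h k < h k.+1 by case: k => [|k] /=; rewrite ?ltrBlDr ?ltrDl.
have hle : {homo h : j k / (j <= k)%N >-> j <= k}.
  by apply: homo_leq => [//|y x z|k]; [exact: le_trans|exact: ltW].
pose n (x : R) := Num.truncn x.
exists (fun x => h (n x) + (x - (n x)%:R) * (h (n x).+1 - h (n x))); last first.
  by move=> k; rewrite /n natrK subrr mul0r addr0.
move=> x y x0 xy; have y0 := lt_trans x0 xy.
have /andP[nx xn] := truncn_itv (ltW x0).
have /andP[ny yn] := truncn_itv (ltW y0).
have : (n x <= n y)%N by exact/le_truncn/ltW.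
have dx := hS (n x); have dy := hS (n y).
rewrite leq_eqVlt => /predU1P[<-|lt_n].
  by rewrite ltrD2l ltr_pM2r ?subr_gt0// ltrD2r.
apply: (@lt_le_trans _ _ (h (n x).+1)).
  rewrite -ltrBrDl gtr_pMl ?subr_gt0//.
  by rewrite ltrBlDr addrC natr1.
apply: (le_trans (hle _ _ lt_n)).
by rewrite lerDl mulr_ge0// subr_ge0// ltW.
Qed.

(** * The case with ties: a minimum carried by a sequence of atoms *)

Section ForwardGeometric.
Context d (T : measurableType d) (R : realType) (P : probability T R).
Variable Z : T -> \bar R.
Hypothesis mZ : measurable_fun setT Z.
Hypothesis Z_gtNy : surv P Z -oo%E = 1.
Hypothesis Z_lty : pr P [set w | Z w = +oo%E] = 0.
Local Notation S := (surv P Z).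
Local Notation gap := (fun s t => pr P [set w | (s < Z w < t)%E]).

Section Rates.
Variables (X Y : T -> \bar R) (p q r : R).
Hypothesis mX : measurable_fun setT X.
Hypothesis mY : measurable_fun setT Y.
Hypothesis H : cause_rates S (surv P X) (surv P Y) gap p q r.
Hypotheses (p0 : 0 < p) (q0 : 0 < q).
Local Notation a := (surv P X).
Local Notation b := (surv P Y).

(** Multiplying the tie bound by [S t = a t * b t] and regrouping yields the product of the two
    lower bounds, hence [r * S t <= p * q * (S s - S t)]. *)
Lemma surv_contracts s t : 0 < r -> (s <= t)%E -> S t < S s ->
  S t <= p * q / (r + p * q) * S s.
Proof.
move=> r0 st Sst; have pq0 : 0 < p * q by rewrite mulr_gt0.
have D0 : 0 < S s - S t by rewrite subr_gt0.
have h : r * (S s - S t) * S t <= p * q * (S s - S t) * (S s - S t).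
  apply: (@le_trans _ _ ((a s - a t) * (b s - b t) * S t)).
    by rewrite ler_wpM2r ?surv_ge0// (eq_rate_le H st).
  rewrite [X in _ * X <= _](ratesM H).
  have -> : (a s - a t) * (b s - b t) * (a t * b t) =
    ((a s - a t) * b t) * ((b s - b t) * a t) by ring.
  have -> : p * q * (S s - S t) * (S s - S t) =
    (p * (S s - S t)) * (q * (S s - S t)) by ring.
  apply: ler_pM; last 2 first.
  - exact: lt_rate_ge H _ _ st.
  - exact: gt_rate_ge H _ _ st.
  - by rewrite mulr_ge0 ?surv_ge0// subr_ge0 le_surv.
  - by rewrite mulr_ge0 ?surv_ge0// subr_ge0 le_surv.
rewrite mulrAC ler_pdivlMr ?addr_gt0//.
have : r * S t <= p * q * (S s - S t) by rewrite -(ler_pM2r D0) mulrAC.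
lra.
Qed.

Section Step.
Variables s t : \bar R.
Hypothesis st : (s <= t)%E.
Hypothesis Sst : S t < S s.
Hypothesis gap0 : gap s t = 0.

Let D0 : 0 < S s - S t. Proof. by rewrite subr_gt0. Qed.

(** With no mass strictly between [s] and [t], the upper and lower bounds of [cause_rates] meet. *)
Let lt_eq : p * (S s - S t) = (a s - a t) * b t.
Proof.
apply/eqP; rewrite eq_le (lt_rate_ge H st) andbT.
by have := lt_rate_gap H st; rewrite gap0 addr0.
Qed.

Let gt_eq : q * (S s - S t) = (b s - b t) * a t.
Proof.
apply/eqP; rewrite eq_le (gt_rate_ge H st) andbT.
by have := gt_rate_gap H st; rewrite gap0 addr0.
Qed.

Let eq_eq : r * (S s - S t) = (a s - a t) * (b s - b t).
Proof.
apply/eqP; rewrite eq_le (eq_rate_le H st) /=.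
by have := eq_rate_gap H st; rewrite gap0 addr0.
Qed.

Let at0 : 0 < a t.
Proof.
rewrite lt_neqAle surv_ge0 andbT; apply/eqP => at0.
by have := mulr_gt0 q0 D0; rewrite gt_eq -at0 mulr0 ltxx.
Qed.

Let bt0 : 0 < b t.
Proof.
rewrite lt_neqAle surv_ge0 andbT; apply/eqP => bt0.
by have := mulr_gt0 p0 D0; rewrite lt_eq -bt0 mulr0 ltxx.
Qed.

Lemma surv_step_gt0 : 0 < S t.
Proof. by rewrite (ratesM H) mulr_gt0. Qed.

(** Positivity of [p] and [q] forces both survival functions to drop from [s] to [t], and the tie
    equality multiplies the two drops. *)
Lemma tie_rate_gt0 : 0 < r.
Proof.
have : 0 < r * (S s - S t); last by rewrite pmulr_lgt0.
have Da : 0 < a s - a t by have := mulr_gt0 p0 D0; rewrite lt_eq pmulr_lgt0.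
have Db : 0 < b s - b t by have := mulr_gt0 q0 D0; rewrite gt_eq pmulr_lgt0.
by rewrite eq_eq mulr_gt0.
Qed.

(** The [gt] equality times [a s - a t] and the tie equality times [a t] have the same right side,
    so [q * (a s - a t) = r * a t], whatever the step. *)
Lemma surv_step : a t = q / (q + r) * a s.
Proof.
have qr0 : 0 < q + r by rewrite addr_gt0// tie_rate_gt0.
have : q * (a s - a t) = r * a t.
  apply: (mulIf (lt0r_neq0 D0)).
  by rewrite mulrAC gt_eq [RHS]mulrAC eq_eq; ring.
move=> h; apply: (mulIf (lt0r_neq0 qr0)).
rewrite mulrAC divfK ?gt_eqF//; lra.
Qed.

End Step.
End Rates.

Section Atoms.
Variable th : R.
Hypothesis th1 : th < 1.
Hypothesis contract : forall s t : \bar R, (s <= t)%E -> S t < S s -> S t <= th * S s.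

(** The next atom is the infimum of the thresholds where [S] is below [S s]. It lies beyond [s]
    because right continuity and contraction keep [S] constant for a while. *)
Lemma next_atom (s : \bar R) : (s < +oo)%E -> 0 < S s ->
  exists t : R, [/\ (s < t%:E)%E, S t%:E < S s & gap s t%:E = 0].
Proof.
move=> sy S0; pose A := [set t : R | S t%:E < S s].
have A0 : A !=set0 by have [t] := surv_eps mZ Z_lty S0; exists t.
have thS : th * S s < S s by rewrite gtr_pMl.
(* By contraction, [S] takes no value strictly between [th * S s] and [S s] to the right of [s]. *)
have gtA (t : R) : (s <= t%:E)%E -> th * S s < S t%:E -> S t%:E = S s.
  move=> st h; apply/eqP; rewrite eq_le le_surv//= leNgt; apply/negP => /contract.
  by move=> /(_ st); rewrite leNgt h.
have [t0 st0] : exists2 t : R, (s < t%:E)%E & S s - (S s - th * S s) < S t%:E.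
  by apply: surv_right; rewrite ?subr_gt0.
rewrite opprB addrC addrNK => /(gtA _ (ltW st0)) St0.
have lbA (t : R) : S t%:E = S s -> lbound A t.
  move=> St u; rewrite /A /= => uS; rewrite leNgt; apply/negP => ut.
  have : S t%:E <= S u%:E by apply: le_surv => //; rewrite lee_fin ltW.
  by rewrite St leNgt uS.
have hA : has_inf A by split=> //; exists t0; exact: lbA.
have t0A : t0 <= inf A by apply: lb_le_inf => //; exact: lbA.
have sA : (s < (inf A)%:E)%E by rewrite (lt_le_trans st0).
exists (inf A); split=> //.
(* Otherwise right continuity would keep [S] equal to [S s] beyond [inf A]. *)
- rewrite ltNge; apply/negP => h.
  have e0 : 0 < S (inf A)%:E - th * S s by rewrite subr_gt0 (lt_le_trans thS).
  have [u] := surv_right P mZ (ltry (inf A)) e0.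
  rewrite lte_fin opprB addrC addrNK => Au.
  have su : (s < u%:E)%E by rewrite (lt_trans sA).
  move=> /(gtA _ (ltW su))/lbA uA.
  have : u <= inf A by exact: lb_le_inf.
  by rewrite leNgt Au.
- apply: gap_eq0 => // u su uA.
  apply: gtA => //; rewrite (lt_le_trans thS)// leNgt; apply/negP => Au.
  have : inf A <= u by apply: ge_inf => //; case: hA.
  by rewrite leNgt uA.
Qed.

Hypothesis atom_gt0 : forall s t : \bar R, (s <= t)%E -> S t < S s ->
  gap s t = 0 -> 0 < S t.

(** [next_atom] is iterated from [-oo]; by [atom_gt0] the survival value stays positive, so the
    iteration never stops. *)
Lemma ex_atom_seq : exists2 g : R -> R, increasing_on_pos g &
  forall k, S (atom_seq g k.+1) < S (atom_seq g k) /\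
            gap (atom_seq g k) (atom_seq g k.+1) = 0.
Proof.
have /choice[f hf] : forall s : \bar R, exists t : R, (s < +oo)%E -> 0 < S s ->
    [/\ (s < t%:E)%E, S t%:E < S s & gap s t%:E = 0].
  move=> s; have [sy|] := boolP ((s < +oo)%E && (0 < S s)).
    by have /andP[/next_atom/[apply]-[t ht]] := sy; exists t.
  by move=> h; exists 0 => sy S0; rewrite sy S0 in h.
pose e k : R := iter k (fun x : R => f x%:E) (f -oo%E).
pose t k : \bar R := if k is k'.+1 then (e k')%:E else -oo%E.
have tS k : t k.+1 = (f (t k))%:E by case: k.
have ty k : (t k < +oo)%E by case: k => [|k]; rewrite /t ?ltry.
have t0 k : 0 < S (t k).
  elim: k => [|k IH]; first by rewrite /t Z_gtNy.
  have [st Sst g0] := hf _ (ty k) IH.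
  by rewrite tS (atom_gt0 (ltW st)).
have eS k : e k < e k.+1.
  by have [+ _ _] := hf _ (ty k.+1) (t0 k.+1); rewrite -tS lte_fin.
have [g g_incr ge] := increasing_extension eS.
have tE k : atom_seq g k = t k by case: k => [|k] //; rewrite /atom_seq ge.
exists g => // k; rewrite !tE tS.
by have [_ Sst g0] := hf _ (ty k) (t0 k).
Qed.

End Atoms.

(** Each atom multiplies the survival function of [X] by [q / (q + r)], so the success parameter is
    [r / (q + r)]. The atoms are those of [Z], hence common to all [X]. *)
Lemma g_geometric_atom_seq (X : {RV P >-> \bar R}) (Y : T -> \bar R) (p q r : R)
    (g : R -> R) :
  measurable_fun setT Y -> 0 < p -> 0 < q ->
  cause_rates S (surv P X) (surv P Y) gap p q r -> increasing_on_pos g ->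
  (forall k, S (atom_seq g k.+1) < S (atom_seq g k) /\
             gap (atom_seq g k) (atom_seq g k.+1) = 0) ->
  g_geometric g X.
Proof.
move=> mY p0 q0 H g_incr hg; have mX : measurable_fun setT X by [].
pose a := surv P X; pose b := surv P Y; pose t := atom_seq g.
have tt k : (t k <= t k.+1)%E by exact/ltW/atom_seq_ltS.
have r0 : 0 < r.
  by have [h1 h2] := hg 0%N; exact: (tie_rate_gt0 H p0 q0 (tt 0%N)).
have qr0 : 0 < q + r by rewrite addr_gt0.
have aNy : a -oo%E = 1.
  have := ratesM H -oo%E; rewrite Z_gtNy -/a -/b => e.
  apply/eqP; rewrite eq_le surv_le1//= e ler_piMr//; first exact: surv_ge0.
  exact: surv_le1.
apply: (@g_geometric_of_surv _ _ _ _ _ _ (q / (q + r))) => //.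
- by rewrite divr_gt0//= ltr_pdivrMr// mul1r ltrDl.
- elim=> [|k IH]; first by rewrite expr0.
  have [h1 h2] := hg k.
  by rewrite (surv_step H p0 q0 (tt k))// IH exprS.
(* Gaps of [Z] become gaps of [X]: [S] is constant and positive before the next atom, so
   [lt_rate_ge] keeps [a] constant there. *)
- move=> k; have [h1 h2] := hg k.
  have S0 : 0 < S (t k).
    by apply: le_lt_trans h1; exact: surv_ge0.
  apply: gap_eq0 => // u tu ug.
  have Su : S u%:E = S (t k).
    apply/eqP; rewrite eq_le le_surv//= -subr_le0 -surv_oc// -h2.
    apply: le_pr; [exact: measurable_oc|exact: measurable_oo|].
    by move=> w /= /andP[-> wu] /=; rewrite (le_lt_trans wu)// lte_fin.
  apply/eqP; rewrite eq_le le_surv//= -subr_le0.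
  have := lt_rate_ge H tu; rewrite Su subrr mulr0 pmulr_lle0//.
  rewrite lt_neqAle surv_ge0 andbT; apply/eqP => b0.
  by have := ratesM H u%:E; rewrite -b0 mulr0 Su => St0; rewrite St0 ltxx in S0.
Qed.

End ForwardGeometric.

(** * From a common law to independence *)

(** This sums a geometric series of increments: [D] is nondecreasing and [D (k + j)] is at most
    [c ^+ j], so [D k <= 0]. *)
Lemma tail_ge_of_increments (R : realType) (c m : R) (G : nat -> R) :
  0 <= c < 1 -> m <= 1 -> (forall k, 0 <= G k) ->
  (forall k, m * c ^+ k <= G k - G k.+1) ->
  forall k, m * c ^+ k <= G k * (1 - c).
Proof.
move=> /andP[c0 c1] m1 G0 hG k; rewrite -subr_le0.
pose D j := m * c ^+ j - G j * (1 - c).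
have DS j : D j <= D j.+1.
  have := ler_wpM2r (ltW (_ : 0 < 1 - c)) (hG j); rewrite subr_gt0 => /(_ c1).
  by rewrite /D exprS; lra.
have Dk j : D k <= D (k + j)%N.
  by elim: j => [|j IH]; rewrite ?addn0// addnS (le_trans IH).
rewrite -/(D k); apply: (@le0_of_expr_bound _ c); first by rewrite c0.
move=> j; apply: (le_trans (Dk j)); rewrite /D lerBlDr.
apply: (@le_trans _ _ (c ^+ j)); last by rewrite lerDl mulr_ge0// subr_ge0 ltW.
rewrite -[leRHS]mul1r exprD mulrA ler_wpM2r ?exprn_ge0//.
apply: (@le_trans _ _ (c ^+ k)); last by rewrite exprn_ile1// ltW.
by rewrite -[leRHS]mul1r ler_wpM2r ?exprn_ge0.
Qed.

Lemma tail_le_of_increments (R : realType) (c m : R) (G : nat -> R) :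
  0 <= c < 1 -> 0 <= m -> (forall k, G k <= c ^+ k) ->
  (forall k, G k - G k.+1 <= m * c ^+ k) ->
  forall k, G k * (1 - c) <= m * c ^+ k.
Proof.
move=> /andP[c0 c1] m0 Gc hG k; rewrite -subr_le0.
pose D j := G j * (1 - c) - m * c ^+ j.
have DS j : D j <= D j.+1.
  have := ler_wpM2r (ltW (_ : 0 < 1 - c)) (hG j); rewrite subr_gt0 => /(_ c1).
  by rewrite /D exprS; lra.
have Dk j : D k <= D (k + j)%N.
  by elim: j => [|j IH]; rewrite ?addn0// addnS (le_trans IH).
rewrite -/(D k); apply: (@le0_of_expr_bound _ c); first by rewrite c0.
move=> j; apply: (le_trans (Dk j)); rewrite /D.
apply: (@le_trans _ _ (c ^+ (k + j) * (1 - c))).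
  rewrite lerBlDr; apply: (@le_trans _ _ (c ^+ (k + j) * (1 - c))).
    by rewrite ler_wpM2r// subr_ge0 ltW.
  by rewrite lerDl mulr_ge0// exprn_ge0.
apply: (@le_trans _ _ (c ^+ (k + j))).
  by rewrite ler_piMr ?exprn_ge0// gerBl.
by rewrite exprD ler_piMl ?exprn_ge0// exprn_ile1// ltW.
Qed.

(** * Tails on the event [X < Y] along a sequence of thresholds *)

Section ConversePair.
Context d (T : measurableType d) (R : realType) (P : probability T R).
Variables X Y : T -> \bar R.
Hypothesis mX : measurable_fun setT X.
Hypothesis mY : measurable_fun setT Y.
Hypothesis XY : forall x y : \bar R,
  pr P [set w | (x < X w)%E && (y < Y w)%E] = surv P X x * surv P Y y.
Local Notation M := (fun w => Order.min (X w) (Y w)).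
Local Notation G t := (pr P ([set w | (t < M w)%E] `&` [set w | (X w < Y w)%E])).

Let mlt : measurable [set w | (X w < Y w)%E].
Proof. by rewrite -[X in measurable X]setTI; exact: measurable_lte. Qed.

Let mM : measurable_fun setT M := measurable_min2 mX mY.

Lemma lt_tail_le t : G t <= surv P M t.
Proof.
apply: le_pr; [|exact: measurable_gt|by move=> w []].
by apply: measurableI => //; exact: measurable_gt.
Qed.

Section Levels.
Variables (x y : R) (t : nat -> \bar R).
Hypotheses (x01 : 0 <= x <= 1) (y01 : 0 <= y <= 1) (xy1 : x * y < 1).
Hypothesis t_le : forall k, (t k <= t k.+1)%E.
Hypothesis Xt : forall k, surv P X (t k) = x ^+ k.
Hypothesis Yt : forall k, surv P Y (t k) = y ^+ k.

Let xy01 : 0 <= x * y < 1.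
Proof. by have [/andP[? _] /andP[? _]] := (x01, y01); rewrite mulr_ge0. Qed.

(** The lower increment bound is [(x ^+ k - x ^+ k.+1) * y ^+ k.+1], a geometric sequence of ratio
    [x * y]. *)
Lemma lt_tail_levels_ge k : (1 - x) * y * (x * y) ^+ k <= G (t k) * (1 - x * y).
Proof.
have [/andP[x0 x1] /andP[y0 y1]] := (x01, y01).
apply: (@tail_ge_of_increments _ (x * y) _ (fun k => G (t k))) => // [|j|j].
- by rewrite mulr_ile1// ?subr_ge0// gerBl.
- exact: pr_ge0.
- have := lt_increment_ge mX mY XY (t_le j); rewrite !Xt !Yt.
  by apply: le_trans; rewrite !exprS exprMn; lra.
Qed.

Lemma lt_tail_levels_le k : G (t k) * (1 - x * y) <= (1 - x) * (x * y) ^+ k.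
Proof.
have [/andP[x0 x1] /andP[y0 y1]] := (x01, y01).
apply: (@tail_le_of_increments _ (x * y) _ (fun k => G (t k))) => // [|j|j].
- by rewrite subr_ge0.
- by apply: le_trans (lt_tail_le _) _; rewrite surv_min2// Xt Yt exprMn.
- apply: le_trans (lt_increment_le mX mY XY (t_le j)) _; rewrite !Xt !Yt.
  by rewrite !exprS exprMn; lra.
Qed.

(** Without mass between levels, [lt_increment_gap] improves the upper bound by the factor [y], and
    it meets the lower one. *)
Lemma lt_tail_levels_exact k :
  (forall j, pr P [set w | (t j < M w < t j.+1)%E] = 0) ->
  G (t k) = (x * y) ^+ k * G (t 0%N).
Proof.
move=> gap0; have [/andP[x0 x1] /andP[y0 y1]] := (x01, y01).
have e j : G (t j) * (1 - x * y) = (1 - x) * y * (x * y) ^+ j.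
  apply/eqP; rewrite eq_le lt_tail_levels_ge andbT.
  apply: (@tail_le_of_increments _ (x * y) _ (fun k => G (t k))) => // [|i|i].
  - by rewrite mulr_ge0// subr_ge0.
  - by apply: le_trans (lt_tail_le _) _; rewrite surv_min2// Xt Yt exprMn.
  - have := lt_increment_gap mX mY XY (t_le i); rewrite gap0 addr0 !Xt !Yt.
    by move/le_trans; apply; rewrite !exprS exprMn; lra.
have c0 : 1 - x * y != 0 by rewrite gt_eqF// subr_gt0.
by apply: (mulIf c0); rewrite -mulrA !e expr0 mulr1 mulrC.
Qed.

End Levels.

(** With [n] levels up to [u], both [G (t u) / surv P M (t u)] and [G (t 0)] lie between
    [(1 - x) * y / (1 - x * y)] and [(1 - x) / (1 - x * y)], an interval of length at most
    [1 - x <= l * u / n]. *)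
Lemma lt_tail_exponential (l m : R) (t : R -> \bar R) :
  0 <= l -> 0 <= m -> 0 < l + m ->
  (forall u v : R, 0 <= u -> u <= v -> (t u <= t v)%E) ->
  (forall u : R, 0 <= u -> surv P X (t u) = expR (- (l * u))) ->
  (forall u : R, 0 <= u -> surv P Y (t u) = expR (- (m * u))) ->
  forall u : R, 0 < u -> G (t u) = surv P M (t u) * G (t 0%R).
Proof.
move=> l0 m0 lm0 t_le Xt Yt u u0.
have bound (n : nat) : (1 <= n)%N ->
    `|G (t u) - surv P M (t u) * G (t 0%R)| * n%:R <= l * u.
  move=> n1; have n0 : 0 < n%:R :> R by rewrite ltr0n.
  pose e := u / n%:R; have e0 : 0 < e by rewrite divr_gt0.
  pose s k := t (k%:R * e).
  have ke k : 0 <= k%:R * e by rewrite mulr_ge0// ltW.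
  have sn : s n = t u by rewrite /s /e mulrC divfK// gt_eqF.
  have s0 : s 0%N = t 0 by rewrite /s mul0r.
  pose x := expR (- (l * e)); pose y := expR (- (m * e)).
  have x0 : 0 < x by exact: expR_gt0.
  have y0 : 0 < y by exact: expR_gt0.
  have x1 : x <= 1 by rewrite expR_le1 oppr_le0 mulr_ge0// ltW.
  have y1 : y <= 1 by rewrite expR_le1 oppr_le0 mulr_ge0// ltW.
  have xy1 : x * y < 1.
    by rewrite -expRD expR_lt1 -opprD -mulrDl oppr_lt0 mulr_gt0.
  have x01 : 0 <= x <= 1 by rewrite x1 ltW.
  have y01 : 0 <= y <= 1 by rewrite y1 ltW.
  have s_le k : (s k <= s k.+1)%E.
    by apply: t_le => //; rewrite ler_pM2r// ler_nat.
  have Xs k : surv P X (s k) = x ^+ k.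
    by rewrite Xt// -expRM_natr; congr expR; ring.
  have Ys k : surv P Y (s k) = y ^+ k.
    by rewrite Yt// -expRM_natr; congr expR; ring.
  have := lt_tail_levels_ge x01 y01 xy1 s_le Xs Ys n.
  have := lt_tail_levels_le x01 y01 xy1 s_le Xs Ys n.
  have := lt_tail_levels_ge x01 y01 xy1 s_le Xs Ys 0%N.
  have := lt_tail_levels_le x01 y01 xy1 s_le Xs Ys 0%N.
  rewrite sn s0 expr0 !mulr1.
  have -> : surv P M (t u) = (x * y) ^+ n by rewrite surv_min2// -sn Xs Ys exprMn.
  set c := (x * y) ^+ n; move: (G (t u)) (G (t 0%R)) => g g0 h1 h2 h3 h4.
  have c0 : 0 <= c by rewrite exprn_ge0// mulr_ge0// ltW.
  have c1 : c <= 1 by rewrite exprn_ile1 ?mulr_ge0// ltW.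
  have le_x : 1 - x <= l * e.
    have : 1 + - (l * e) <= x by exact: expR_ge1Dx.
    lra.
  have D0 : 0 < 1 - x * y by rewrite subr_gt0.
  have : `|g - c * g0| * (1 - x * y) <= (1 - x) * (1 - x * y).
    rewrite -{1}(gtr0_norm D0) -normrM mulrBl -mulrA.
    have k1 := ler_wpM2l c0 h1; have k2 := ler_wpM2l c0 h2.
    have w0 : 0 <= (1 - x) * (1 - y) by rewrite mulr_ge0// subr_ge0.
    have w1 : c * ((1 - x) * (1 - y)) <= (1 - x) * (1 - y) by rewrite ler_piMl.
    have w2 : (1 - x) * (1 - y) <= (1 - x) * (1 - x * y).
      rewrite ler_wpM2l ?subr_ge0// lerD2l lerN2.
      by rewrite ler_piMl// ltW.
    by rewrite ler_norml; apply/andP; split; lra.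
  rewrite ler_pM2r// => h.
  rewrite -ler_pdivlMr//; apply: (le_trans h); apply: (le_trans le_x).
  by rewrite /e mulrA.
have := @le0_of_mul_invn _ _ _ _ bound.
by rewrite normr_le0 subr_eq0 => /eqP.
Qed.

End ConversePair.

(* For an exponential V, the level sets of g(V) only depend on a threshold [s]
   that is infinite or in the range of [g], whatever the rate. *)
Lemma exponential_level (R : realType) (g : R -> R) (t : R) :
  increasing_on_pos g ->
  exists2 s : \bar R, [\/ s = -oo%E, s = +oo%E | exists2 u, 0 < u & s = (g u)%:E] &
    forall l, 0 < l ->
      exponential_prob l [set v | 0 < v /\ t < g v] =
      exponential_prob l [set v | 0 < v /\ (s < (g v)%:E)%E].
Proof.
(* [A] is an initial segment of the positive reals: empty, unbounded, or with a supremum [u]. The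
   respective thresholds are [-oo], [+oo] and [g u]. *)
move=> g_incr; pose A := [set v | 0 < v /\ g v <= t].
have [A0|A0] := eqVneq A set0.
  exists -oo%E; first by constructor 1.
  move=> l _; congr exponential_prob; apply/seteqP; split => v /= [v0 _]; split=> //.
    by rewrite ltNyr.
  by rewrite ltNge; apply/negP => gv; have : A v by []; rewrite A0.
have {}A0 : A !=set0 by apply/set0P.
have [ubA|nubA] := pselect (has_ubound A); last first.
  exists +oo%E; first by constructor 2.
  move=> l _; congr exponential_prob; apply/seteqP; split => v /= [v0 h] //.
  exfalso; apply: nubA; exists v => z [z0 gz].
  rewrite leNgt; apply/negP => /(g_incr _ _ v0) gvz.
  by have := lt_trans h (lt_le_trans gvz gz); rewrite ltxx.
have hA : has_sup A by [].
pose u := sup A.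
have u0 : 0 < u.
  have [z [z0 gz]] := A0; apply: (lt_le_trans z0).
  by apply: ub_le_sup.
exists (g u)%:E; first by constructor 3; exists u.
move=> l l0; have [mu muE] := exponential_probability l0.
have -> : [set v | 0 < v /\ ((g u)%:E < (g v)%:E)%E] = `]u, +oo[%classic.
  apply/seteqP; split => v /=; rewrite in_itv/= andbT lte_fin.
    move=> [v0 guv]; rewrite ltNge; apply/negP.
    rewrite le_eqVlt => /predU1P[vu|/(g_incr _ _ v0) gvu].
      by rewrite vu ltxx in guv.
    by have := lt_trans guv gvu; rewrite ltxx.
  by move=> uv; split; [exact: lt_trans uv|exact: g_incr].
have mS : measurable ([set v | 0 < v /\ t < g v] : set R).
  have := measurable_pos_preimage g_incr (measurable_eray t%:E).
  by under eq_set do rewrite /= lte_fin.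
(* The set where [t < g v] lies between []u, +oo[] and [[u, +oo[], which have the same exponential
   mass. *)
apply/eqP; rewrite eq_le; apply/andP; split.
  rewrite (exponential_prob_itvoy l0 (ltW u0)) -(exponential_prob_itvcy l0 (ltW u0)).
  rewrite -!muE. apply: le_measure; rewrite ?inE//.
  move=> v /= [v0 tv]; rewrite in_itv/= andbT; apply: sup_le_ub => // z [z0 gz].
  rewrite leNgt; apply/negP => /(g_incr _ _ v0) gvz.
  by have := lt_trans tv (lt_le_trans gvz gz); rewrite ltxx.
rewrite -!muE; apply: le_measure; rewrite ?inE//.
move=> v /=; rewrite in_itv/= andbT => uv.
have v0 : 0 < v := lt_trans u0 uv.
split=> //; rewrite ltNge; apply/negP => gv.
have : v <= u by apply: ub_le_sup.
by rewrite leNgt uv.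
Qed.

Lemma atom_seq_level (R : realType) (g : R -> R) (t : \bar R) (k : nat) :
  increasing_on_pos g -> (atom_seq g k <= t)%E -> (t < atom_seq g k.+1)%E ->
  [set j : nat | (0 < j)%N /\ (t < (g j%:R)%:E)%E] =
  [set j : nat | (0 < j)%N /\ (atom_seq g k < (g j%:R)%:E)%E].
Proof.
move=> g_incr kt tk; apply/seteqP; split=> -[|j] [//= _].
  by move=> tj; split=> //; exact: le_lt_trans tj.
rewrite -[(g _)%:E]/(atom_seq g j.+1) => kj; split=> //.
apply: (lt_le_trans tk); apply: atom_seq_le => //.
rewrite ltnNge; apply/negP => jk.
by have := lt_le_trans kj (atom_seq_le g_incr jk); rewrite ltxx.
Qed.

(** The threshold is rounded down to the last term of [atom_seq g] not above it, or replaced by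
    [+oo] if no term exceeds it. *)
Lemma geometric_level (R : realType) (g : R -> R) (t : R) :
  increasing_on_pos g ->
  exists2 s : \bar R, s = +oo%E \/ (exists k, s = atom_seq g k) &
    [set j : nat | (0 < j)%N /\ (t%:E < (g j%:R)%:E)%E] =
    [set j : nat | (0 < j)%N /\ (s < (g j%:R)%:E)%E].
Proof.
move=> g_incr.
have [[k tk]|nk] := pselect (exists k, (t%:E < atom_seq g k)%E); last first.
  exists +oo%E; first by left.
  apply/seteqP; split=> -[|j] [//= _] h //.
  by exfalso; apply: nk; exists j.+1.
have exk : exists k, (t%:E < atom_seq g k)%E by exists k.
case: (ex_minnP exk) => -[//|m] tm min_m.
exists (atom_seq g m); first by right; exists m.
apply: atom_seq_level => //; rewrite leNgt; apply/negP => /min_m.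
by rewrite ltnn.
Qed.

Section Tails.
Context d (T : measurableType d) (R : realType) (P : probability T R).
Variable Z : T -> \bar R.
Hypothesis mZ : measurable_fun setT Z.
Hypothesis Z_gtNy : surv P Z -oo%E = 1.
Local Notation S := (surv P Z).
Local Notation tail t := [set w | (t < Z w)%E].

Lemma pr_tail_Ny (E : set T) : measurable E -> pr P (tail -oo%E `&` E) = pr P E.
Proof.
move=> mE; have mt := measurable_gt mZ -oo%E.
apply/eqP; rewrite eq_le le_pr//=; last exact: measurableI.
have := pr_setU_le P (measurableI _ _ mt mE) (measurableC mt).
rewrite pr_setC// -[pr P [set w | _]]/(S -oo%E) Z_gtNy subrr addr0.
apply: le_trans; apply: le_pr => //.
  by apply: measurableU; [exact: measurableI|exact: measurableC].
by move=> w Ew; have [?|?] := pselect (tail -oo%E w); [left|right].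
Qed.

(** One tail contains the other and has the same probability, so they differ by a null event. *)
Lemma pr_tail_eq (s t : \bar R) (E : set T) : measurable E -> S s = S t ->
  pr P (tail s `&` E) = pr P (tail t `&` E).
Proof.
move=> mE.
have mt x : measurable (tail x `&` E) by apply: measurableI => //; exact: measurable_gt.
have le x y : (x <= y)%E -> S x = S y -> pr P (tail x `&` E) <= pr P (tail y `&` E).
  move=> xy Sxy; rewrite -[leRHS]addr0 -[X in _ + X](subrr (S x)).
  rewrite {2}Sxy -(surv_oc P mZ xy); apply: le_trans (pr_setU_le P _ _) => //; last first.
    exact: measurable_oc.
  apply: le_pr => //; first by apply: measurableU => //; exact: measurable_oc.
  move=> w /= [xw Ew]; have [yw|wy] := ltP y (Z w); first by left.
  by right; rewrite xw.
have ge x y : (x <= y)%E -> pr P (tail y `&` E) <= pr P (tail x `&` E).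
  by move=> xy; apply: le_pr => // w /= [yw Ew]; split=> //; exact: le_lt_trans yw.
move=> Sst; apply/eqP; rewrite eq_le.
by have [st|/ltW ts] := leP s t; [rewrite le// ge|rewrite ge// le].
Qed.

Lemma independent_of_eventP (E : set T) : measurable E ->
  independent_of_event P Z E <->
  forall t : R, pr P (tail t%:E `&` E) = S t%:E * pr P E.
Proof.
move=> mE.
suff h (t : R) : (P ([set w | Z w <= t%:E]%E `&` E) = P [set w | Z w <= t%:E]%E * P E)%E
    <-> pr P (tail t%:E `&` E) = S t%:E * pr P E.
  by split=> H t; apply/h.
have mt := measurable_gt mZ t%:E.
have mlt := measurable_le mZ t%:E.
rewrite !prE//; last exact: measurableI.
have -> : [set w | (Z w <= t%:E)%E] = ~` tail t%:E.
  by apply/seteqP; split => w /=; rewrite leNgt => /negP.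
rewrite (pr_setC P mt) setIC -setDE.
have -> : E `\` tail t%:E = E `\` (tail t%:E `&` E).
  by apply/seteqP; split => w /= [Ew h]; split=> // hh; apply: h; tauto.
rewrite pr_setD//; last exact: measurableI.
rewrite -[pr P (tail _)]/(S _) -EFinM mulrBl mul1r; split=> [[]|->//].
lra.
Qed.

Lemma indep_tail_of_real (E : set T) : measurable E ->
  (forall t : R, pr P (tail t%:E `&` E) = S t%:E * pr P E) -> indep_tail P Z E.
Proof.
move=> mE h [t| |]; first exact: h.
  have n0 : tail +oo%E = set0 by apply/seteqP; split => w //=; rewrite ltNge leey.
  by rewrite /surv n0 set0I pr_set0 mul0r.
by rewrite pr_tail_Ny// Z_gtNy mul1r.
Qed.

End Tails.

Lemma measurable_bigmin d (T : measurableType d) (R : realType) (I : Type)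
    (s : seq I) (Q : pred I) (f : I -> T -> \bar R) :
  (forall i, measurable_fun setT (f i)) ->
  measurable_fun setT (fun w => \big[Order.min/+oo%E]_(i <- s | Q i) f i w).
Proof.
move=> mf; elim: s => [|i s IH].
  by under eq_fun do rewrite big_nil; exact: measurable_cst.
under eq_fun do rewrite big_cons.
by case: (Q i) => //; exact: measurable_mine.
Qed.

(** * The family of variables and the minimum of the others *)

Section Family.
Context d (T : measurableType d) (R : realType) (P : probability T R).
Variable n : nat.
Hypothesis hn : (2 <= n)%N.
Variable X : 'I_n -> {RV P >-> \bar R}.
Hypothesis X_indep : mutually_independent X.
Hypothesis X_finite : forall i : 'I_n, {ae P, forall w, X i w \is a fin_num}.

Local Notation M := (min_all X).
Local Notation Y := (min_others X).

Let mX i : measurable_fun setT (X i). Proof. by []. Qed.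

Lemma measurable_min_all : measurable_fun setT M.
Proof. by apply: measurable_bigmin => i; exact: mX. Qed.

Lemma measurable_min_others i : measurable_fun setT (Y i).
Proof. by apply: measurable_bigmin => j; exact: mX. Qed.

Lemma min_allE i : M = fun w => Order.min (X i w) (Y i w).
Proof. by apply/funext => w; rewrite /min_all (bigminD1 i). Qed.

Lemma surv_X_Ny i : surv P (X i) -oo%E = 1.
Proof.
have [N [mN N0 hN]] := X_finite i.
have m := measurable_gt (mX i) -oo%E.
apply/eqP; rewrite eq_le surv_le1//= /surv -subr_le0 -pr_setC//.
have -> : 0 = pr P N by rewrite /pr N0.
apply: le_pr => //; first exact: measurableC.
move=> w /= h; apply: hN => /= fw; apply: h.
by rewrite ltNye; apply/eqP => e; rewrite e in fw.
Qed.

Lemma pr_X_y i : pr P [set w | X i w = +oo%E] = 0.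
Proof.
have [N [mN N0 hN]] := X_finite i.
apply/eqP; rewrite eq_le pr_ge0 andbT.
have -> : 0 = pr P N by rewrite /pr N0.
apply: le_pr => //.
  by rewrite -[X in measurable X]setTI; exact: (mX i _ (emeasurable_set1 +oo%E)).
by move=> w /= h; apply: hN => /= fw; rewrite h in fw.
Qed.

Lemma surv_y (Z : T -> \bar R) : surv P Z +oo%E = 0.
Proof.
rewrite -(pr_set0 P); congr pr; apply/seteqP; split => w //=.
by rewrite ltNge leey.
Qed.

Lemma pr_indep (B : 'I_n -> set (\bar R)) : (forall j, measurable (B j)) ->
  pr P (\bigcap_(j in [set: 'I_n]) (X j @^-1` B j)) = \prod_j pr P (X j @^-1` B j).
Proof.
move=> mB.
have mXB j : measurable (X j @^-1` B j).
  by rewrite -[X in measurable X]setTI; exact: mX.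
apply/EFin_inj; rewrite -prodEFin -prE; last by apply: fin_bigcap_measurable.
by rewrite X_indep//; apply: eq_bigr => j _; rewrite -prE.
Qed.

Lemma ex_other (i : 'I_n) : exists j : 'I_n, j != i.
Proof.
have n0 : (0 < n)%N by exact: leq_trans hn.
have [i0|i0] := eqVneq i (Ordinal n0); last by exists (Ordinal n0); rewrite eq_sym.
by exists (Ordinal hn); rewrite i0.
Qed.

Lemma pr_X_others i (A : set (\bar R)) (y : \bar R) : measurable A ->
  pr P (X i @^-1` A `&` [set w | (y < Y i w)%E]) =
  pr P (X i @^-1` A) * \prod_(j | j != i) surv P (X j) y.
Proof.
(* At [y = +oo] both sides vanish; on the right this takes an index other than [i], which exists
   because [2 <= n]. *)
move=> mA; have [->|yy] := eqVneq y +oo%E.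
  have -> : [set w | (+oo < Y i w)%E] = set0.
    by apply/seteqP; split => w //=; rewrite ltNge leey.
  have [j ji] := ex_other i.
  by rewrite setI0 pr_set0 (bigD1 j)//= surv_y mul0r mulr0.
pose B j := if j == i then A else [set z : \bar R | (y < z)%E].
have -> : X i @^-1` A `&` [set w | (y < Y i w)%E] =
    \bigcap_(j in [set: 'I_n]) (X j @^-1` B j).
  apply/seteqP; split => w.
    move=> [Aw /bigmin_gtP[_ h]] j _; rewrite /B /preimage /=.
    by case: eqVneq => [->//|ji]; exact: h.
  move=> h; split.
    by have := h i I; rewrite /B /preimage /= eqxx.
  apply/bigmin_gtP; split; first by rewrite ltey.
  by move=> j ji; have := h j I; rewrite /B /preimage /= (negbTE ji).
rewrite pr_indep; last by move=> j; rewrite /B; case: ifP => // _; exact: measurable_eray.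
rewrite (bigD1 i)//= /B eqxx; congr (_ * _).
by apply: eq_bigr => j /negbTE ->.
Qed.

Lemma surv_others i (y : \bar R) :
  surv P (Y i) y = \prod_(j | j != i) surv P (X j) y.
Proof.
have := pr_X_others i y measurableT.
by rewrite preimage_setT setTI pr_setT mul1r.
Qed.

Lemma X_others_indep i (x y : \bar R) :
  pr P [set w | (x < X i w)%E && (y < Y i w)%E] = surv P (X i) x * surv P (Y i) y.
Proof.
rewrite surv_others -(pr_X_others i y (measurable_eray x)); congr pr.
by apply/seteqP; split => w /=; [case/andP|case=> -> ->].
Qed.

Lemma surv_min_all (y : \bar R) : surv P M y = \prod_j surv P (X j) y.
Proof.
pose i := Ordinal hn.
rewrite (min_allE i) (surv_min2 (X_others_indep i)) surv_others.
by rewrite [RHS](bigD1 i).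
Qed.

Lemma min_all_gtNy : surv P M -oo%E = 1.
Proof. by rewrite surv_min_all big1// => j _; exact: surv_X_Ny. Qed.

Lemma min_all_lty : pr P [set w | M w = +oo%E] = 0.
Proof.
pose i := Ordinal hn.
apply/eqP; rewrite eq_le pr_ge0 andbT -(pr_X_y i); apply: le_pr.
- rewrite -[X in measurable X]setTI.
  exact: (measurable_min_all _ (emeasurable_set1 +oo%E)).
- by rewrite -[X in measurable X]setTI; exact: (mX i _ (emeasurable_set1 +oo%E)).
- by move=> w /= Mw; apply/eqP; rewrite -leye_eq -Mw; exact: bigmin_le.
Qed.

Let mlt i : measurable [set w | (X i w < Y i w)%E].
Proof.
by rewrite -[X in measurable X]setTI; apply: measurable_lte => //;
  exact: measurable_min_others.
Qed.

Let mgt i : measurable [set w | (Y i w < X i w)%E].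
Proof.
by rewrite -[X in measurable X]setTI; apply: measurable_lte => //;
  exact: measurable_min_others.
Qed.

Let meq i : measurable [set w | X i w = Y i w].
Proof.
by rewrite -[X in measurable X]setTI; apply: measurable_eqe => //;
  exact: measurable_min_others.
Qed.

Lemma pr_tie i (B : set T) : measurable B ->
  pr P (B `&` [set w | X i w = Y i w]) =
  pr P B - pr P (B `&` [set w | (X i w < Y i w)%E]) -
  pr P (B `&` [set w | (Y i w < X i w)%E]).
Proof.
move=> mB.
have ml := measurableI _ _ mB (mlt i); have mg := measurableI _ _ mB (mgt i).
rewrite -pr_setD//.
rewrite -pr_setD//; last 2 first.
- exact: measurableD.
- move=> w /= [Bw YX]; split=> // -[_ XY].
  by have := lt_trans XY YX; rewrite ltxx.
congr pr; apply/seteqP; split => w /=.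
  by move=> [Bw ->]; rewrite ltxx; split; [split=> // -[]|move=> []].
move=> [[Bw nXY] nYX]; split=> //; apply/eqP; rewrite eq_le !leNgt.
by apply/andP; split; apply/negP => h; [apply: nYX|apply: nXY].
Qed.

(** By [pr_tie], the condition on ties follows from the two others. *)
Lemma time_cause_independentP : time_cause_independent X <->
  forall i, indep_tail P M [set w | (X i w < Y i w)%E] /\
            indep_tail P M [set w | (Y i w < X i w)%E].
Proof.
have mM := measurable_min_all; have MNy := min_all_gtNy.
split=> [h i|h i].
  by have [h1 h2 h3] := h i; split; apply: indep_tail_of_real => //;
    exact/independent_of_eventP.
have [h1 h2] := h i; split; apply/independent_of_eventP => // t.
have := pr_tie i measurableT; rewrite pr_setT !setTI => ->.
rewrite pr_tie; last exact: measurable_gt.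
by rewrite h1 h2 -[pr P [set w | (t%:E < M w)%E]]/(surv P M t%:E); ring.
Qed.

Lemma indep_tie i :
  indep_tail P M [set w | (X i w < Y i w)%E] ->
  indep_tail P M [set w | (Y i w < X i w)%E] ->
  indep_tail P M [set w | X i w = Y i w].
Proof.
move=> h1 h2 t.
have := pr_tie i measurableT; rewrite pr_setT !setTI => ->.
rewrite pr_tie; last exact/measurable_gt/measurable_min_all.
by rewrite h1 h2 -[pr P [set w | (t < M w)%E]]/(surv P M t); ring.
Qed.

Lemma common_law_of_independence :
  (forall i : 'I_n, (0 < P [set w | X i w > min_others X i w])%E) ->
  (forall i : 'I_n, (0 < P [set w | X i w < min_others X i w])%E) ->
  time_cause_independent X ->
  exists2 g : R -> R, increasing_on_pos g &
    (forall i : 'I_n, g_exponential g (X i)) \/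
    (forall i : 'I_n, g_geometric g (X i)).
Proof.
move=> X_gt X_lt /time_cause_independentP ind.
have mM := measurable_min_all; have MNy := min_all_gtNy; have My := min_all_lty.
have p0 i : 0 < pr P [set w | (X i w < Y i w)%E] by rewrite -lte_fin -prE.
have q0 i : 0 < pr P [set w | (Y i w < X i w)%E] by rewrite -lte_fin -prE.
have rates i : cause_rates (surv P M) (surv P (X i)) (surv P (Y i))
    (fun s t => pr P [set w | (s < M w < t)%E])
    (pr P [set w | (X i w < Y i w)%E]) (pr P [set w | (Y i w < X i w)%E])
    (pr P [set w | X i w = Y i w]).
  have [h1 h2] := ind i.
  apply: cause_rates_of_indep => //.
  - exact: measurable_min_others.
  - exact: X_others_indep.
  - exact: min_allE.
  - exact: indep_tie.
(* The tie probability at one index decides the case: the quantile and the atom sequence depend on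
   [M] only and serve every [i]. *)
pose i0 := Ordinal hn; have mY0 := measurable_min_others i0.
have := pr_ge0 P [set w | X i0 w = Y i0 w]; rewrite le_eqVlt => /predU1P[r0|r0].
  have nj : exists2 c : R, 0 < c & forall s t : R, s < t ->
      c * (surv P M s%:E - surv P M t%:E) ^+ 2 <=
      pr P [set w | (s%:E < M w < t%:E)%E].
    exists (pr P [set w | (X i0 w < Y i0 w)%E] * pr P [set w | (Y i0 w < X i0 w)%E]).
      exact: mulr_gt0.
    by apply: (no_jump_of_rates mM (mX i0) mY0) => //; rewrite r0.
  exists (quantile P M); first exact: quantile_increasing.
  left=> i; have mYi := measurable_min_others i.
  exact: (g_exponential_quantile mM MNy My nj mYi (p0 i) (rates i)).
pose pq := pr P [set w | (X i0 w < Y i0 w)%E] * pr P [set w | (Y i0 w < X i0 w)%E].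
have pq0 : 0 < pq by exact: mulr_gt0.
have th1 : pq / (pr P [set w | X i0 w = Y i0 w] + pq) < 1.
  by rewrite ltr_pdivrMr ?addr_gt0// mul1r ltrDr.
have [s t st Sst|s t st Sst g0|g g_incr hg] := ex_atom_seq mM MNy My th1.
- exact: (surv_contracts (mX i0) mY0 (rates i0) (p0 i0) (q0 i0) r0).
- exact: (surv_step_gt0 (rates i0) (p0 i0) (q0 i0) st).
- exists g => //; right=> i.
  exact: (g_geometric_atom_seq mM MNy (measurable_min_others i) (p0 i) (q0 i) (rates i)).
Qed.

Lemma independence_of_g_exponential (g : R -> R) : increasing_on_pos g ->
  (forall i, g_exponential g (X i)) -> time_cause_independent X.
Proof.
move=> g_incr gX.
have mM := measurable_min_all; have MNy := min_all_gtNy.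
have /choice[l hl] : forall j, exists lj : R, 0 < lj /\
    forall t : \bar R, (surv P (X j) t)%:E =
      exponential_prob lj [set v : R | 0 < v /\ (t < (g v)%:E)%E].
  move=> j; have [l l0 hl] := gX j.
  by exists l; split=> //; exact: surv_of_g_exponential.
pose t (u : R) : \bar R := if 0 < u then (g u)%:E else -oo%E.
have t_le (u v : R) : 0 <= u -> u <= v -> (t u <= t v)%E.
  rewrite /t; case: ifPn => [u0 _|]; last by rewrite leNye.
  rewrite le_eqVlt => /predU1P[<-|uv]; first by rewrite u0.
  by rewrite (lt_trans u0 uv) lee_fin ltW// g_incr.
have Xt j (u : R) : 0 <= u -> surv P (X j) (t u) = expR (- (l j * u)).
  rewrite le_eqVlt => /predU1P[<-|u0].
    by rewrite /t ltxx mulr0 oppr0 expR0 surv_X_Ny.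
  have [lj0 hj] := hl j.
  apply/EFin_inj; rewrite hj /t u0 -exponential_prob_itvoy ?ltW//.
  congr exponential_prob; apply/seteqP; split => v /=; rewrite in_itv/= andbT lte_fin.
    move=> [v0 guv]; rewrite ltNge; apply/negP.
    rewrite le_eqVlt => /predU1P[vu|/(g_incr _ _ v0) gvu].
      by rewrite vu ltxx in guv.
    by have := lt_trans guv gvu; rewrite ltxx.
  by move=> uv; split; [exact: lt_trans uv|exact: g_incr].
(* Survival functions multiply, so the minimum of the others has the sum of their rates. *)
have Yt i (u : R) : 0 <= u ->
    surv P (Y i) (t u) = expR (- ((\sum_(j | j != i) l j) * u)).
  move=> u0; rewrite surv_others mulr_suml -sumrN expR_sum.
  by apply: eq_bigr => j _; rewrite Xt.
have m0 i : 0 <= \sum_(j | j != i) l j.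
  by apply: sumr_ge0 => j _; have [/ltW] := hl j.
(* An arbitrary threshold is exchanged for an infinite one or some [t u]; the exchange is the same
   for all rates, hence valid for [M]. *)
have level (s : R) (E : set T) : measurable E ->
    (forall u : R, 0 < u -> pr P ([set w | (t u < M w)%E] `&` E) =
       surv P M (t u) * pr P ([set w | (t 0%R < M w)%E] `&` E)) ->
    pr P ([set w | (s%:E < M w)%E] `&` E) = surv P M s%:E * pr P E.
  move=> mE hE; have [s' hs' es] := exponential_level s g_incr.
  have Ss : surv P M s%:E = surv P M s'.
    rewrite !surv_min_all; apply: eq_bigr => j _; have [lj0 hj] := hl j.
    by apply/EFin_inj; rewrite !hj -(es _ lj0).
  rewrite (pr_tail_eq mM mE Ss) Ss; case: hs' => [->|->|[u u0 ->]].
  - by rewrite pr_tail_Ny// MNy mul1r.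
  - rewrite surv_y mul0r (_ : [set w | (+oo < M w)%E] = set0) ?set0I ?pr_set0//.
    by apply/seteqP; split => w //=; rewrite ltNge leey.
  - by have := hE u u0; rewrite {3}/t ltxx pr_tail_Ny// /t u0.
apply/time_cause_independentP => i; have [li0 hi] := hl i.
have mYi := measurable_min_others i.
have lm0 : 0 < l i + \sum_(j | j != i) l j by rewrite ltr_pwDl.
split; apply: indep_tail_of_real => // s; apply: level => // u u0.
  rewrite (min_allE i).
  exact: (lt_tail_exponential (mX i) mYi (X_others_indep i)
    (ltW li0) (m0 i) lm0 t_le (Xt i) (Yt i) u0).
have -> : M = fun w => Order.min (Y i w) (X i w).
  by rewrite (min_allE i); apply/funext => w; rewrite minC.
rewrite addrC in lm0.
exact: (lt_tail_exponential mYi (mX i) (indep_pairC (X_others_indep i))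
  (m0 i) (ltW li0) lm0 t_le (Yt i) (Xt i) u0).
Qed.

Lemma independence_of_g_geometric (g : R -> R) : increasing_on_pos g ->
  (forall i, g_geometric g (X i)) -> time_cause_independent X.
Proof.
move=> g_incr gX.
have mM := measurable_min_all; have MNy := min_all_gtNy.
pose t := atom_seq g.
have /choice[x hx] : forall j, exists xj : R, [/\ 0 < xj < 1,
    forall k, surv P (X j) (t k) = xj ^+ k &
    forall y : \bar R, (surv P (X j) y)%:E =
     geometric_prob (1 - xj) [set k : nat | (0 < k)%N /\ (y < (g k%:R)%:E)%E]].
  move=> j; have [a /andP[a0 a1] ha] := gX j.
  have x01 : 0 < 1 - a < 1 by rewrite subr_gt0 a1 ltrBlDr ltrDl.
  rewrite -(subKr 1 a) in ha.
  by have [h1 h2] := surv_of_g_geometric g_incr x01 ha; exists (1 - a).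
(* A threshold matters only through the set of integers that [g] maps above it, whatever the success
   parameters. *)
have surv_eq (y z : \bar R) : [set j : nat | (0 < j)%N /\ (y < (g j%:R)%:E)%E] =
      [set j : nat | (0 < j)%N /\ (z < (g j%:R)%:E)%E] ->
    surv P M y = surv P M z.
  move=> yz; rewrite !surv_min_all; apply: eq_bigr => j _.
  by have [_ _ h] := hx j; apply/EFin_inj; rewrite !h yz.
have gap0 k : pr P [set w | (t k < M w < t k.+1)%E] = 0.
  apply: gap_eq0 => // y ty yt; apply: surv_eq.
  by apply: atom_seq_level => //; rewrite lte_fin.
have t_le k : (t k <= t k.+1)%E by exact/ltW/atom_seq_ltS.
have Yt i k : surv P (Y i) (t k) = (\prod_(j | j != i) x j) ^+ k.
  by rewrite surv_others -prodrXl; apply: eq_bigr => j _; have [_ ->] := hx j.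
have x01 i : 0 <= x i <= 1 by have [/andP[/ltW -> /ltW ->]] := hx i.
have y01 i : 0 <= \prod_(j | j != i) x j <= 1.
  rewrite prodr_ge0 => [|j _]; last by have /andP[] := x01 j.
  by apply: prodr_ile1 => j _; exact: x01.
have xy1 i : x i * \prod_(j | j != i) x j < 1.
  have [/andP[xi0 xi1] _ _] := hx i; have /andP[yi0 yi1] := y01 i.
  by apply: le_lt_trans xi1; rewrite ler_piMr// ltW.
have level (s : R) (E : set T) : measurable E ->
    (forall k, pr P ([set w | (t k < M w)%E] `&` E) =
       surv P M (t k) * pr P ([set w | (t 0%N < M w)%E] `&` E)) ->
    pr P ([set w | (s%:E < M w)%E] `&` E) = surv P M s%:E * pr P E.
  move=> mE hE; have [s' hs' /surv_eq Ss] := geometric_level s g_incr.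
  rewrite (pr_tail_eq mM mE Ss) Ss; case: hs' => [->|[k ->]].
    rewrite surv_y mul0r (_ : [set w | (+oo < M w)%E] = set0) ?set0I ?pr_set0//.
    by apply/seteqP; split => w //=; rewrite ltNge leey.
  by rewrite hE pr_tail_Ny.
apply/time_cause_independentP => i; have [_ Xt _] := hx i.
have mYi := measurable_min_others i.
split; apply: indep_tail_of_real => // s; apply: level => // k.
  rewrite (min_allE i) surv_min2; last exact: X_others_indep.
  rewrite Xt Yt -exprMn.
  apply: (lt_tail_levels_exact (mX i) mYi (X_others_indep i) (x01 i) (y01 i)) => // j.
  by have := gap0 j; rewrite (min_allE i).
have MYX : M = fun w => Order.min (Y i w) (X i w).
  by rewrite (min_allE i); apply/funext => w; rewrite minC.
rewrite MYX (surv_min2 (indep_pairC (X_others_indep i))) Xt Yt -exprMn.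
apply: (lt_tail_levels_exact mYi (mX i) (indep_pairC (X_others_indep i))
  (y01 i) (x01 i)) => //.
  by rewrite mulrC.
by move=> j; have := gap0 j; rewrite MYX.
Qed.

End Family.

Local Open Scope ereal_scope.

Theorem corollary1 (d : measure_display) (T : measurableType d)
    (R : realType) (P : probability T R) (n : nat) (hn : (2 <= n)%N)
    (X : 'I_n -> {RV P >-> \bar R})
    (X_indep : mutually_independent X)
    (X_finite : forall i : 'I_n, {ae P, forall w, X i w \is a fin_num})
    (X_gt : forall i : 'I_n, 0 < P [set w | X i w > min_others X i w])
    (X_lt : forall i : 'I_n, 0 < P [set w | X i w < min_others X i w]) :
  time_cause_independent X <->
  exists2 g : R -> R, increasing_on_pos g &
    (forall i : 'I_n, g_exponential g (X i)) \/
    (forall i : 'I_n, g_geometric g (X i)).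
Proof.
split; first exact: common_law_of_independence.
by move=> [g g_incr [|]]; [exact: independence_of_g_exponential|
  exact: independence_of_g_geometric].
Qed.
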